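(* Let $f\colon X\to Y$ be a perfect map between paracompact spaces such that $\dim f\le n$ and $\dim Y=0$. Then, for every $m\ge n+1$, the space $C^*(X,\mathbb{R}^m)$ (with the source limitation topology) contains a dense $G_\delta$-subset $\mathcal{H}$ of maps $g$ such that $\dim\big( g(f^{-1}(y))\cap\Pi^d\big)\le n+d-m$ for every $y\in Y$ and every $d$-plane $\Pi^d\subset\mathbb{R}^m$ with $m-n\le d\le m$.
   Context: All maps are continuous and all spaces are at least completely regular (Hausdorff). $n\ge 0$ is an integer. $\dim$ is covering dimension ($\dim\emptyset=-1$), and $\dim f=\sup\{\dim f^{-1}(y):y\in Y\}$. A perfect map is a closed continuous map with compact fibers. A $d$-plane $\Pi^d\subset\mathbb{R}^m$ is a $d$-dimensional affine plane. $C^*(X,\mathbb{R}^m)$ is the set of all bounded continuous maps $X\to\mathbb{R}^m$. Source limitation topology: with $\varrho$ the Euclidean metric, a set $U\subset C^*(X,\mathbb{R}^m)$ is open iff for every $g\in U$ there is a continuous function $\alpha\colon X\to(0,\infty)$ such that $\overline{B}(g,\alpha)=\{h\in C^*(X,\mathbb{R}^m):\varrho(g(x),h(x))\le\alpha(x)\text{ for each }x\in X\}\subset U$. *)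

(* Defs.v *)
From HB Require Import structures.
From mathcomp Require Import all_boot all_order all_algebra.
From mathcomp Require Import all_classical all_reals all_analysis.
From mathcomp Require Export borel_hierarchy.
Set Implicit Arguments.
Unset Strict Implicit.
Unset Printing Implicit Defensive.
Import Order.TTheory GRing.Theory Num.Theory.
Import numFieldNormedType.Exports.
Local Open Scope classical_set_scope.
Local Open Scope card_scope.
Local Open Scope ring_scope.

Definition tychonoff_space (T : topologicalType) : Prop :=
  hausdorff_space T /\ completely_regular_space T.

Definition open_cover (T : topologicalType) (U : set (set T)) : Prop :=
  (forall A, U A -> open A) /\ \bigcup_(A in U) A = setT.

Definition refines (T : Type) (V U : set (set T)) : Prop :=
  forall B, V B -> exists2 A, U A & B `<=` A.

Definition locally_finite (T : topologicalType) (V : set (set T)) : Prop :=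
  forall x : T, exists2 N, nbhs x N &
    finite_set [set B | V B /\ B `&` N !=set0].

Definition paracompact_space (T : topologicalType) : Prop :=
  hausdorff_space T /\
  forall U : set (set T), open_cover U ->
    exists V : set (set T), [/\ open_cover V, refines V U & locally_finite V].

Definition perfect_map (X Y : topologicalType) (f : X -> Y) : Prop :=
  [/\ continuous f,
      forall C : set X, closed C -> closed (f @` C) &
      forall y : Y, compact (f @^-1` [set y])].

(* [covdim_lt T k] reads dim T <= k - 1: every finite open cover has a finite
   open refinement no point of which lies in more than k members, that is, of
   order at most k - 1.  The shift allows k = 0, i.e. dim T = -1, which holds
   exactly when T is empty. *)
Definition covdim_lt (T : topologicalType) (k : nat) : Prop :=
  forall U : set (set T), finite_set U -> open_cover U ->
    exists V : set (set T),
      [/\ finite_set V, open_cover V, refines V U &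
          forall x : T, [set B | V B /\ B x] #<= `I_k].

(* The infimum of the empty set is +oo, so covdim R T = +oo when no k works;
   R only serves to host the values -1, 0, 1, ... and +oo. *)
Definition covdim (R : realType) (T : topologicalType) : \bar R :=
  ereal_inf [set (k%:R - 1)%:E | k in covdim_lt T].

Definition covdim_map (R : realType) (X Y : topologicalType) (f : X -> Y) :
    \bar R :=
  ereal_sup [set covdim R (set_type (f @^-1` [set y])) | y in [set: Y]].

Definition affine_plane (R : realType) (m d : nat) (P : set 'rV[R]_m) : Prop :=
  exists (p : 'rV[R]_m) (W : {vspace 'rV[R]_m}),
    \dim W = d /\ P = [set p + w | w in [set w | w \in W]].

(* The norm provided by the library on 'rV[R]_m is the sup norm. *)
Definition eucl_dist (R : realType) (m : nat) (u v : 'rV[R]_m) : R :=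
  Num.sqrt (\sum_(i < m) (u 0 i - v 0 i) ^+ 2).

Section bounded_continuous_maps.
Variables (X : topologicalType) (R : realType) (m : nat).

Record bcmap := BCMap {
  bcmap_fun :> X -> 'rV[R]_m;
  bcmap_continuous : continuous bcmap_fun;
  bcmap_bounded : bounded_fun bcmap_fun }.

HB.instance Definition _ := gen_eqMixin bcmap.
HB.instance Definition _ := gen_choiceMixin bcmap.

Definition source_limitation_ball (g : bcmap) (a : X -> R) : set bcmap :=
  [set h | forall x, eucl_dist (g x) (h x) <= a x].

Definition source_limitation_open (U : set bcmap) : Prop :=
  forall g, U g -> exists a : X -> R,
    [/\ continuous a, forall x, 0 < a x & source_limitation_ball g a `<=` U].

Let source_limitation_openT : source_limitation_open setT.
Proof.
move=> g _; exists (fun=> 1); split=> // x; exact: cst_continuous.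
Qed.

Let source_limitation_openI : setI_closed source_limitation_open.
Proof.
move=> U V oU oV g [/oU[a [ca a0 aU]] /oV[b [cb b0 bV]]].
exists (a \min b); split.
- by move=> x; apply: continuous_min; [exact: ca|exact: cb].
- by move=> x; rewrite /= lt_min a0 b0.
- by move=> h gh; split; [apply: aU|apply: bV] => x;
    have := gh x; rewrite /= le_min => /andP[].
Qed.

Let source_limitation_open_bigU (I : Type) (F : I -> set bcmap) :
  (forall i, source_limitation_open (F i)) ->
  source_limitation_open (\bigcup_i F i).
Proof.
move=> oF g [i _ Fig]; have [a [ca a0 aF]] := oF i g Fig.
by exists a; split=> // h /aF Fih; exists i.
Qed.

HB.instance Definition _ := isOpenTopological.Build bcmap
  source_limitation_openT source_limitation_openI source_limitation_open_bigU.

Lemma bcmap_openE (U : set bcmap) : open U = source_limitation_open U.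
Proof. by []. Qed.

End bounded_continuous_maps.

(* Main.v *)
Require Import Defs.
From HB Require Import structures.
From mathcomp Require Import all_boot all_order all_algebra.
From mathcomp Require Import all_classical all_reals all_analysis.
From mathcomp Require Import ring lra zify.
Set Implicit Arguments.
Unset Strict Implicit.
Unset Printing Implicit Defensive.
Import Order.TTheory GRing.Theory Num.Theory.
Import numFieldNormedType.Exports.
Local Open Scope classical_set_scope.
Local Open Scope ring_scope.

(** Call a subset of R^m null if, for every e > 0, it is covered by finitely
many balls whose radii add up to less than e.  Put c = m - n.  Everything
rests on the following property of a compact set A, here A = g(f^-1(y)):
the section of A by every plane of codimension n is null.

This property gives the dimension estimate.  Let P be a plane of dimension
d >= c and p = d - c = n + d - m.  Then p linear coordinates send A `&` P to
R^p, and their fibres are sections of A by planes of codimension n, hence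
null.  A null set misses hyperplanes x_i = t with t in any given interval, so
each fibre, and by compactness each neighbouring one, is cut into small
disjoint open pieces.  On the other hand R^p is covered by p + 1 families of
disjoint small open cubes, namely the grids of some mesh shifted along the
diagonal by multiples of 1/(p + 1): a point has only p coordinates, so some
grid avoids all of them.  Cutting the inverse image of every cube gives covers
of order p ([covdim_lt_null_fibers]).

The property is generic.  A plane of codimension n is given by an invertible
matrix and a base point; those with entries bounded by N form a compact space,
so the condition [thin_slices], that all the corresponding sections have
content less than e, persists when A is thickened or moved a little
([thin_slices_thicken]).  Let H be the intersection over k of the sets of maps
g all of whose fibre images are thin for N = k + 1 and e = 1/(k + 1).  These
sets are open; the topology is complete enough for Baire's argument to apply
([baire_bcmap]), so they only have to be dense.

For the density, the nerve of a fine cover replaces g near a fibre by a map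
into a polyhedron whose simplices have at most n + 1 vertices and small
diameter.  A plane of codimension n meets such a simplex in at most one point,
unless one of its vertices is an affine combination of the plane and of all
but one of the other vertices.  Thus each excess simplex costs one parameter
in the choice of the vertices, and excess simplices without common vertices
cost independent parameters.  The planes depend on at most D = m^2 + m
parameters, so for vertices in general position no plane has more than D
pairwise disjoint excess simplices ([generic_position]); every other excess
simplex touches one of these.  A section of the polyhedron therefore lies in a
finite set and D balls of radius comparable to the mesh
([polyhedron_content_lt]), and has small content.  General position itself is
a count: a Lipschitz image of a cube of dimension at most M - 1 cannot contain
all points of a fine grid in dimension M ([avoid_images]).

Finally Y is paracompact with dim Y = 0, so choices made near the points of Y
can be made locally constant ([locally_constant_selection]); this turns the
statements near one fibre into statements about all of X. *)


(** * Images of lower-dimensional Lipschitz maps miss points *)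

(** Only the coordinates in [A] enter the bound, so that such an [F] does not
depend on the others: this is how maps of #|A| variables are expressed inside
a fixed set of variables. *)
Definition lip_on (R : realType) (J : finType) (r : R) (A : {set J})
    (F : (J -> R) -> R) : Prop :=
  exists2 L, 0 <= L & forall (s t : J -> R) (e : R), 0 <= e ->
    (forall j, `|s j| <= r) -> (forall j, `|t j| <= r) ->
    (forall j, j \in A -> `|s j - t j| <= e) -> `|F s - F t| <= L * e.

Section lip_on_theory.
Variables (R : realType) (J : finType) (r : R) (A : {set J}).
Hypothesis r0 : 0 <= r.
Implicit Types F G : (J -> R) -> R.

Lemma lip_on_coord j : j \in A -> lip_on r A (fun s => s j).
Proof. by move=> jA; exists 1 => // s t e e0 _ _ /(_ j jA); rewrite mul1r. Qed.

Lemma lip_onD F G : lip_on r A F -> lip_on r A G ->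
  lip_on r A (fun s => F s + G s).
Proof.
move=> [K K0 FK] [L L0 GL]; exists (K + L); first exact: addr_ge0.
move=> s t e e0 sr tr st; rewrite opprD addrACA mulrDl.
by apply: (le_trans (ler_normD _ _)); apply: lerD; [exact: FK|exact: GL].
Qed.

Lemma lip_onN F : lip_on r A F -> lip_on r A (fun s => - F s).
Proof.
move=> [K K0 FK]; exists K => // s t e e0 sr tr st.
by rewrite -opprD normrN; exact: FK.
Qed.

Lemma lip_onM F G : lip_on r A F -> lip_on r A G ->
  lip_on r A (fun s => F s * G s).
Proof.
move=> [K K0 FK] [L L0 GL].
have z0 : forall j : J, `|(0 : R)| <= r by move=> j; rewrite normr0.
have bnd (H : (J -> R) -> R) M : (forall (s t : J -> R) (e : R), 0 <= e ->
    (forall j, `|s j| <= r) -> (forall j, `|t j| <= r) ->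
    (forall j, j \in A -> `|s j - t j| <= e) -> `|H s - H t| <= M * e) ->
    forall s, (forall j, `|s j| <= r) -> `|H s| <= `|H (fun=> 0)| + M * r.
  move=> HM s sr; rewrite -[H s](subrKC (H (fun=> 0))).
  apply: (le_trans (ler_normD _ _)); rewrite lerD2l.
  by apply: HM => // j _; rewrite subr0.
exists ((`|F (fun=> 0)| + K * r) * L + (`|G (fun=> 0)| + L * r) * K).
  by rewrite addr_ge0 // mulr_ge0 // addr_ge0 // mulr_ge0.
move=> s t e e0 sr tr st.
have -> : F s * G s - F t * G t = F s * (G s - G t) + G t * (F s - F t) by ring.
apply: (le_trans (ler_normD _ _)); rewrite !normrM mulrDl -!mulrA.
by apply: lerD; apply: ler_pM => //; [exact: bnd|exact: GL|exact: bnd|exact: FK].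
Qed.

Lemma lip_on_sum (I : finType) (P : pred I) (F : I -> (J -> R) -> R) :
  (forall i, P i -> lip_on r A (F i)) -> lip_on r A (fun s => \sum_(i | P i) F i s).
Proof.
move=> FL.
suff: forall q : seq I, lip_on r A (fun s => \sum_(i <- q | P i) F i s) by [].
elim=> [|i q IH].
  by exists 0 => // s t e *; rewrite !big_nil subrr normr0 mul0r.
have [Pi|nPi] := boolP (P i).
  have [L L0 HL] := lip_onD (FL _ Pi) IH.
  by exists L => // s t e e0 sr tr st; rewrite !big_cons Pi; exact: HL.
have [L L0 HL] := IH.
by exists L => // s t e e0 sr tr st; rewrite !big_cons (negbTE nPi); exact: HL.
Qed.

End lip_on_theory.

Lemma grid_approx (R : realType) (r : R) (k : nat) (x : R) : 0 < r -> `|x| <= r ->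
  exists i : 'I_k.+1, `|x - (i%:R / k.+1%:R * (2 * r) - r)| <= 2 * r / k.+1%:R.
Proof.
move=> r0; rewrite ler_norml => /andP[xr rx].
have k0 : (0 : R) < k.+1%:R by rewrite ltr0n.
set y := (x + r) / (2 * r) * k.+1%:R.
have y0 : 0 <= y by rewrite mulr_ge0 // divr_ge0 //; lra.
have yk : y <= k.+1%:R.
  by rewrite -[leRHS]mul1r ler_pM2r // ler_pdivrMr; lra.
have xE : x = y / k.+1%:R * (2 * r) - r.
  by rewrite /y mulfK ?lt0r_neq0 // divfK; [ring|lra].
have key (i : nat) : `|y - i%:R| <= 1 ->
    `|x - (i%:R / k.+1%:R * (2 * r) - r)| <= 2 * r / k.+1%:R.
  move=> yi; rewrite xE.
  have -> : y / k.+1%:R * (2 * r) - r - (i%:R / k.+1%:R * (2 * r) - r) =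
     (y - i%:R) * (2 * r / k.+1%:R) by ring.
  have p0 : 0 < 2 * r / k.+1%:R by rewrite divr_gt0 //; lra.
  by rewrite normrM (gtr0_norm p0) ler_piMl // ltW.
have [/eqP yE|ynk] := boolP (y == k.+1%:R).
  exists ord_max; apply: key; rewrite yE /= -natrB ?leqnSn // subSnn.
  by rewrite normr1.
have /truncn_itv/andP[ty yt] := y0.
have tk : (Num.truncn y < k.+1)%N.
  rewrite -(ltr_nat R); apply: (le_lt_trans ty).
  by rewrite lt_neqAle ynk.
exists (Ordinal tk); apply: key => /=.
by rewrite ler_norml; move: yt; rewrite -natr1; lra.
Qed.

(** By pigeonhole on a grid of k^#|J'| points around [w]: a map [F t] takes
nearly equal values on each of about (C k)^#|A t| small cells, too few for all
the grid points once k is large, because #|A t| < #|J'|. *)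
Lemma avoid_images (R : realType) (J J' T : finType) (r a : R)
    (A : T -> {set J}) (F : T -> (J -> R) -> J' -> R) (w : J' -> R) :
  0 < r -> 0 < a -> (forall t, (#|A t| < #|J'|)%N) ->
  (forall t x, lip_on r (A t) (fun s => F t s x)) ->
  exists v : J' -> R, (forall x, `|v x - w x| <= a) /\
    forall t s, (forall j, `|s j| <= r) -> ~ (forall x, F t s x = v x).
Proof.
move=> r0 a0 cA lipF.
have {lipF} [L L0 HL] : exists2 L, 0 <= L & forall t x (s s' : J -> R) (e : R),
    0 <= e -> (forall j, `|s j| <= r) -> (forall j, `|s' j| <= r) ->
    (forall j, j \in A t -> `|s j - s' j| <= e) -> `|F t s x - F t s' x| <= L * e.
  have /choice[f Hf] : forall tx : T * J', exists L, 0 <= L /\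
      forall (s s' : J -> R) (e : R),
      0 <= e -> (forall j, `|s j| <= r) -> (forall j, `|s' j| <= r) ->
      (forall j, j \in A tx.1 -> `|s j - s' j| <= e) ->
      `|F tx.1 s tx.2 - F tx.1 s' tx.2| <= L * e.
    by move=> [t x]; have [L] := lipF t x; exists L.
  exists (\sum_tx f tx); first by apply: sumr_ge0 => i _; have [] := Hf i.
  move=> t x s s' e e0 sr s'r ss'.
  have [_ /(_ _ _ _ e0 sr s'r ss') /le_trans] := Hf (t, x); apply.
  rewrite ler_wpM2r // (bigD1 (t, x)) //= lerDl.
  by apply: sumr_ge0 => i _; have [] := Hf i.
have [t0|] := pselect (exists t : T, True); last first.
  move=> nT; exists w; split=> [x|t]; first by rewrite subrr normr0 ltW.
  by exfalso; apply: nT; exists t.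
have J'0 : (0 < #|J'|)%N by have [t _] := t0; exact: leq_trans (cA t).
(* The cells are C times finer than the grid, so that the image of a cell is
   narrower than the mesh 2 * a / k.+1 of the grid. *)
pose C := (Num.truncn (2 * r * L / a)).+1.
have CL : 2 * r * L / a < C%:R by exact: truncnS_gt.
pose k := (#|T| * C ^ #|J'|.-1)%N.
pose K := (C * k.+1).-1.
have KE : K.+1 = (C * k.+1)%N by rewrite prednK.
pose v (u : {ffun J' -> 'I_k.+1}) x := w x + ((u x)%:R / k.+1%:R * (2 * a) - a).
have k0 : (0 : R) < k.+1%:R by rewrite ltr0n.
have vw u x : `|v u x - w x| <= a.
  rewrite /v addrAC subrr add0r ler_norml.
  have : 0 <= (u x)%:R / k.+1%:R * (2 * a).
    by rewrite mulr_ge0 ?divr_ge0 //; lra.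
  have : (u x)%:R / k.+1%:R * (2 * a) <= 1 * (2 * a).
    rewrite ler_pM2r; last lra.
    by rewrite ler_pdivrMr // mul1r ler_nat ltnW.
  by move: (_ / _ * _) => z; lra.
apply: contrapT => /forallNP noV.
have /choice[g Hg] : forall u : {ffun J' -> 'I_k.+1}, exists ts : T * (J -> R),
    (forall j, `|ts.2 j| <= r) /\ forall x, F ts.1 ts.2 x = v u x.
  move=> u; have /not_andP[|] := noV (v u); first by [].
  move=> /existsNP[t] /existsNP[s] /not_implyP[sr] /contrapT Fs.
  by exists (t, s).
have /choice[h Hh] : forall x : R, exists i : 'I_K.+1, `|x| <= r ->
    `|x - (i%:R / K.+1%:R * (2 * r) - r)| <= 2 * r / K.+1%:R.
  move=> x; have [xr|nxr] := pselect (`|x| <= r); last by exists ord0.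
  by have [i] := grid_approx K r0 xr; exists i.
pose c u : {ffun J -> 'I_K.+1} :=
  [ffun j => if j \in A (g u).1 then h ((g u).2 j) else ord0].
have cinj u u' : (g u).1 = (g u').1 -> c u = c u' -> u = u'.
  move=> guu' cuu'; apply/ffunP => x.
  have [sr Fs] := Hg u; have [s'r Fs'] := Hg u'.
  have d : `|v u x - v u' x| <= L * (2 * (2 * r / K.+1%:R)).
    rewrite -Fs -Fs' -guu'; apply: HL => //.
      by rewrite mulr_ge0 // divr_ge0 //; lra.
    move=> j jA; have := congr1 (fun f : {ffun _ -> _} => f j) cuu'.
    rewrite /= !ffunE -guu' jA => hE.
    have := Hh _ (sr j); have := Hh _ (s'r j); rewrite hE.
    set b := (_ / _ * _ - r) => h1 h2.
    have -> : (g u).2 j - (g u').2 j = ((g u).2 j - b) - ((g u').2 j - b) by ring.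
    apply: (le_trans (ler_normB _ _)).
    by rewrite [leRHS]mulr_natl mulr2n lerD.
  apply/val_inj/eqP; apply/negPn/negP => ne.
  have dv : v u x - v u' x = ((u x)%:R - (u' x)%:R) * (2 * a / k.+1%:R).
    by rewrite /v; ring.
  have p0 : 0 < 2 * a / k.+1%:R by rewrite divr_gt0 //; lra.
  have one : 1 <= `|(u x)%:R - (u' x)%:R : R|.
    have [lt|lt|E] := ltngtP (u x) (u' x).
    - rewrite distrC -natrB; last exact: ltnW.
      by rewrite ger0_norm // ler1n subn_gt0.
    - rewrite -natrB; last exact: ltnW.
      by rewrite ger0_norm // ler1n subn_gt0.
    - by move/eqP: ne => /(_ E).
  have : 2 * a / k.+1%:R <= L * (2 * (2 * r / K.+1%:R)).
    apply: le_trans d; rewrite dv normrM (gtr0_norm p0).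
    by rewrite -[leLHS]mul1r ler_pM2r.
  have C0 : (0 : R) < C%:R by rewrite ltr0n.
  rewrite KE natrM leNgt => /negP; apply.
  have -> : L * (2 * (2 * r / (C%:R * k.+1%:R))) =
      (2 * r * L / a) / C%:R * (2 * a / k.+1%:R).
    by field; rewrite !lt0r_neq0.
  by rewrite -[ltRHS]mul1r ltr_pM2r // ltr_pdivrMr // mul1r.
have cnt : (#|{: {ffun J' -> 'I_k.+1}}| <= #|T| * K.+1 ^ #|J'|.-1)%N.
  rewrite -sum1_card (partition_big (fun u => (g u).1) xpredT) //=.
  rewrite -sum_nat_const; apply: leq_sum => t _.
  rewrite sum1_card -(card_in_imset (f := c)); last first.
    by move=> u u'; rewrite !unfold_in => /eqP ut /eqP u't; apply: cinj; rewrite ut u't.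
  apply: (@leq_trans #|pffun_on (ord0 : 'I_K.+1) (A t) predT|).
    apply/subset_leq_card/fintype.subsetP => f /imsetP[u].
    rewrite unfold_in => /eqP ut ->.
    apply/pffun_onP; split=> //; apply/fintype.subsetP => j; rewrite inE ffunE ut.
    by case: ifP => //; rewrite eqxx.
  rewrite card_pffun_on card_ord leq_pexp2l //.
  by rewrite -ltnS prednK.
move: cnt; rewrite card_ffun card_ord leqNgt => /negP; apply.
rewrite KE expnMn mulnA -/k -[X in (_ < _ ^ X)%N](prednK J'0) expnS.
by rewrite ltn_pmul2r // expn_gt0.
Qed.

(** * Vertices in general position with respect to all planes *)

(** In the basis of the rows of the inverse of [M], the coordinates of [v] are
[v *m M]; the plane through [p] is parallel to the first [c] basis vectors. *)
Definition plane_of (R : realType) (m c : nat) (M : 'M[R]_m) (p : 'rV[R]_m) :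
    set 'rV[R]_m :=
  [set v | forall l : 'I_m, (c <= l)%N -> ((v - p) *m M) 0 l = 0].

Definition frame (R : realType) (m : nat) (N : R) (M M' : 'M[R]_m) (p : 'rV[R]_m) :=
  [/\ M *m M' = 1%:M, forall i j, `|M i j| <= N, forall i j, `|M' i j| <= N &
      forall j, `|p 0 j| <= N].

(** Two distinct affine combinations of the vertices in [S] fall in the plane.
Affine rather than convex combinations, since all that is counted is the linear
dependence that they give. *)
Definition excess_simplex (R : realType) (m c : nat) (I : finType)
    (v : I -> 'rV[R]_m) (M : 'M[R]_m) (p : 'rV[R]_m) (S : {set I}) :=
  exists a b : I -> R,
    [/\ forall i, i \notin S -> a i = 0 /\ b i = 0, \sum_i a i = 1, \sum_i b i = 1,
        plane_of c M p (\sum_i a i *: v i) /\ plane_of c M p (\sum_i b i *: v i) &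
        a <> b].

(** The two combinations give two independent linear relations between the
vertices modulo the plane.  Eliminating [i1] leaves one relation, which is then
solved for the vertex [i0] with the largest coefficient; hence the bound on
[t], needed because only bounded parameters can be counted. *)
Lemma excess_simplex_dependence (R : realType) (m c : nat) (I : finType)
    (v : I -> 'rV[R]_m) (M : 'M[R]_m) (p : 'rV[R]_m) (S : {set I}) :
  excess_simplex c v M p S ->
  exists (i0 i1 : I) (t : I -> R), [/\ i0 \in S, i1 \in S, i0 != i1,
    forall i, `|t i| <= 1 &
    plane_of c M p (v i0 - \sum_(i in S :\ i0 :\ i1) t i *: (v i - p))].
Proof.
move=> [a [b [ab0 a1 b1 [pa pb] ab]]].
have rel (x : I -> R) : \sum_i x i = 1 -> plane_of c M p (\sum_i x i *: v i) ->
    forall l : 'I_m, (c <= l)%N -> ((\sum_i x i *: (v i - p)) *m M) 0 l = 0.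
  move=> x1 px l cl; rewrite -(px l cl); congr ((_ *m _) _ _).
  under eq_bigr do rewrite scalerBr.
  by rewrite sumrB -scaler_suml x1 scale1r.
have [i1 ai1] : exists i, a i != 0.
  apply: contrapT => /forallNP na; move/eqP: a1; rewrite big1 ?(eq_sym 0) ?oner_eq0 //.
  by move=> i _; apply/eqP/negPn/negP/na.
pose d i := b i1 * a i - a i1 * b i.
have d1 : d i1 = 0 by rewrite /d mulrC subrr.
have [i0' di0'] : exists i, d i != 0.
  apply: contrapT => /forallNP nd; apply: ab.
  have d0 i : b i1 * a i = a i1 * b i.
    by apply/eqP; rewrite -subr_eq0; apply/negPn/negP/nd.
  have : \sum_i b i1 * a i = \sum_i a i1 * b i by apply: eq_bigr => i _.
  rewrite -!mulr_sumr a1 b1 !mulr1 => ba.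
  by apply/funext => i; apply: (mulfI ai1); rewrite -d0 ba.
have [i0 _ maxd] := @arg_maxP _ R I i0' xpredT (fun i => `|d i|) isT.
have di0 : d i0 != 0.
  by rewrite -normr_gt0 (lt_le_trans _ (maxd i0' isT)) // normr_gt0.
have dS i : i \notin S -> d i = 0.
  by move=> /ab0[ai bi]; rewrite /d ai bi !mulr0 subrr.
have i0S : i0 \in S by apply/negPn/negP => /dS/eqP; exact/negP.
have i1S : i1 \in S.
  by apply/negPn/negP => /ab0[/eqP + _]; exact/negP.
have i01 : i0 != i1 by apply: contra_neq di0 => ->.
exists i0, i1, (fun i => - (d i / d i0)); split => // [i|l cl].
  by rewrite normrN normf_div ler_pdivrMr ?normr_gt0 // mul1r; exact: maxd.
have d0 : ((\sum_i d i *: (v i - p)) *m M) 0 l = 0.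
  have -> : \sum_i d i *: (v i - p) = b i1 *: (\sum_i a i *: (v i - p)) -
      a i1 *: (\sum_i b i *: (v i - p)).
    rewrite !scaler_sumr -sumrB; apply: eq_bigr => i _.
    by rewrite !scalerA -scalerBl.
  rewrite mulmxBl -!scalemxAl.
  move: (rel a a1 pa l cl) (rel b b1 pb l cl).
  move: (_ *m M) (_ *m M) => x y xl yl.
  by rewrite !mxE xl yl !mulr0 subrr.
have E : \sum_i d i *: (v i - p) = d i0 *: (v i0 -
    \sum_(i in S :\ i0 :\ i1) - (d i / d i0) *: (v i - p) - p).
  rewrite addrAC scalerBr scaler_sumr (bigD1 i0) //=; congr (_ + _).
  rewrite (bigID (mem (S :\ i0 :\ i1))) /= [X in _ + X]big1 ?addr0; last first.
    move=> i /andP[ii0]; rewrite !inE ii0 /= negb_and negbK => /orP[/eqP ->|/dS ->].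
      by rewrite d1 scale0r.
    by rewrite scale0r.
  rewrite -sumrN; apply: eq_big => [i|i _].
    by rewrite !inE; case: (i == i0); rewrite ?andbF.
  by rewrite scalerA mulrN mulrCA divff // mulr1 scaleNr opprK.
move: d0; rewrite E -scalemxAl mxE => /eqP.
by rewrite mulf_eq0 (negbTE di0) => /eqP.
Qed.

Lemma le_summands (R : realType) (x y z : R) : 0 < x -> 0 < y -> 0 <= z ->
  [/\ 0 < x + y + 1 + z, x <= x + y + 1 + z, y <= x + y + 1 + z,
      1 <= x + y + 1 + z & z <= x + y + 1 + z].
Proof. by move=> x0 y0 z0; split; lra. Qed.

(** For a family of excess simplices, every vertex [i0] of
[excess_simplex_dependence] is a polynomial in the frame, the other vertices,
the c coordinates of a displacement along the plane and the at most n - 1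
coefficients [t]: these are c + n - 1 = m parameters in place of m + 1
coordinates.  With more excess simplices than parameters for the frame, all
the vertices together are a function of too few parameters, and
[avoid_images] applies. *)
Lemma generic_position (R : realType) (m n : nat) (I : finType)
    (w : I -> 'rV[R]_m.+1) (e N : R) : (n <= m)%N -> 0 < e -> 0 < N ->
  exists v : I -> 'rV[R]_m.+1, (forall i j, `|v i 0 j - w i 0 j| <= e) /\
    forall M M' p, frame N M M' p ->
    forall S : 'I_(m.+1 * m.+1 + m.+1).+1 -> {set I},
      (forall j k i, i \in S j -> i \in S k -> j = k) ->
      (forall j, #|S j| <= n.+1)%N ->
      ~ (forall j, excess_simplex (m.+1 - n) v M p (S j)).
Proof.
move=> nm e0 N0; set D := (_ * _ + _)%N; set c := (m.+1 - n)%N.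
pose data := ({set I} * I * I)%type.
pose valid (t : {ffun 'I_D.+1 -> data}) :=
  [forall j, [&& (t j).1.2 \in (t j).1.1, (t j).2 \in (t j).1.1,
     (t j).1.2 != (t j).2 & (#|(t j).1.1| <= n.+1)%N]] &&
  [forall j, forall k, forall i,
     (i \in (t j).1.1) ==> (i \in (t k).1.1) ==> (j == k)].
pose T := {t : {ffun 'I_D.+1 -> data} | valid t}.
pose J := ((I * 'I_m.+1) + ('I_m.+1 * 'I_m.+1 + 'I_m.+1))%type.
pose J' := (I * 'I_m.+1)%type.
pose i0 (t : T) (j : 'I_D.+1) := (val t j).1.2.
pose i1 (t : T) (j : 'I_D.+1) := (val t j).2.
pose S (t : T) (j : 'I_D.+1) := (val t j).1.1.
pose S' (t : T) (j : 'I_D.+1) := S t j :\ i0 t j :\ i1 t j.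
(* Z t collects the one free parameter saved at each vertex i0 t j: of the
   m.+1 slots of that vertex, c hold a displacement along the plane and the
   following ones hold the coefficients of the other vertices, of which there
   are at most n - 1; the slot ord_max stays empty. *)
pose Z (t : T) : {set J} := (fun j => inl (i0 t j, ord_max)) @: 'I_D.+1.
pose slot (t : T) j i : 'I_m.+1 := inord (c + index i (enum (S' t j))).
pose F (t : T) (s : J -> R) (x : J') : R :=
  if [pick j | i0 t j == x.1] is Some j then
    s (inr (inr x.2)) +
    \sum_(k : 'I_m.+1 | (k < c)%N) s (inl (x.1, k)) * s (inr (inl (k, x.2))) +
    \sum_(i in S' t j) s (inl (x.1, slot t j i)) *
                         (s (inl (i, x.2)) - s (inr (inr x.2)))
  else s (inl x).
have v1 (t : T) j : [/\ i0 t j \in S t j, i1 t j \in S t j, i0 t j != i1 t j &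
    (#|S t j| <= n.+1)%N].
  by have /andP[/forallP/(_ j)/and4P] := valP t.
have v2 (t : T) j k i : i \in S t j -> i \in S t k -> j = k.
  have /andP[_ /forallP/(_ j)/forallP/(_ k)/forallP/(_ i)] := valP t.
  by move=> /implyP h /h /implyP h' /h' /eqP.
have i0inj (t : T) : injective (i0 t).
  move=> j k jk; apply: (v2 t j k (i0 t j)); first by have [] := v1 t j.
  by rewrite jk; have [] := v1 t k.
have cS' (t : T) j : (#|S' t j| < n)%N.
  have [h0 h1 ne hS] := v1 t j; move: hS.
  rewrite (cardsD1 (i0 t j)) h0 (cardsD1 (i1 t j)) !inE eq_sym ne h1 /=.
  by rewrite -/(S' t j); lia.
have cm (t : T) (j : 'I_D.+1) : (c <= m)%N by have := cS' t j; rewrite /c; lia.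
have slotE (t : T) j i : i \in S' t j ->
    slot t j i = (c + index i (enum (S' t j)))%N :> nat /\ (slot t j i < m)%N.
  move=> iS; have : (index i (enum (S' t j)) < #|S' t j|)%N.
    by rewrite cardE index_mem mem_enum.
  move=> lt; have := cS' t j; rewrite /slot /c => lt'.
  by rewrite inordK //; lia.
have notZ (t : T) i l : (inl (i, l) \in ~: Z t) =
    ~~ ((l == ord_max) && [exists j, i0 t j == i]).
  rewrite inE; congr (~~ _); apply/imsetP/andP.
    by move=> [j _ [-> ->]]; split=> //; apply/existsP; exists j.
  by move=> [/eqP -> /existsP[j /eqP <-]]; exists j.
have notZr (t : T) x : inr x \in ~: Z t by rewrite inE; apply/imsetP => -[].
have notmax (k : 'I_m.+1) : (k < m)%N -> k != ord_max.
  by move=> km; rewrite -val_eqE /= neq_ltn km.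
have S'0 (t : T) j i k : i \in S' t j -> i0 t k != i.
  rewrite !inE => /and3P[_ ii0 iS]; apply/eqP => E.
  move: ii0; rewrite -E (v2 t k j i) ?eqxx // -E.
  by have [] := v1 t k.
pose V : R := \sum_i \sum_j `|w i 0 j| + e.
have V0 : 0 < V by rewrite ltr_wpDl //; do 2 ! apply: sumr_ge0 => ? _.
(* r bounds the vertices, the frame, the coefficients t and the displacements
   along the plane. *)
pose r : R := V + N + 1 + m.+1%:R * ((#|I|.+1%:R * (V + N)) * N).
have rr : 0 <= m.+1%:R * ((#|I|.+1%:R * (V + N)) * N).
  by apply: mulr_ge0 => //; apply: mulr_ge0 (ltW N0); rewrite mulr_ge0 // addr_ge0 // ltW.
have [r0 Vr Nr r1 Xr] : [/\ 0 < r, V <= r, N <= r, 1 <= r &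
    m.+1%:R * ((#|I|.+1%:R * (V + N)) * N) <= r] by exact: le_summands.
have [|t x|v [vw hv]] := @avoid_images R J J' T r e (fun t => ~: Z t) F
    (fun x => w x.1 0 x.2) r0 e0.
- move=> t; have cZ : #|Z t| = D.+1.
    by rewrite /Z card_imset ?card_ord // => j k [/i0inj].
  have cJ : #|{: J}| = (#|{: J'}| + D)%N.
    by rewrite /J /J' !card_sum !card_prod !card_ord.
  by have := cardsC (Z t); rewrite cZ cJ => h; rewrite -(ltn_add2l D.+1) h addnC addSn.
- have r0' := ltW r0; rewrite /F; case: pickP => [j /eqP jx|nj].
    apply: lip_onD => //; first apply: lip_onD => //; first exact: lip_on_coord.
      apply: lip_on_sum => // k kc.
      apply: lip_onM => //; apply: lip_on_coord => //.
      by rewrite notZ negb_and notmax // (leq_trans kc) // (cm t).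
    apply: lip_on_sum => // i iS; apply: lip_onM => //.
      apply: lip_on_coord; rewrite notZ negb_and notmax //.
      by have [] := slotE _ _ _ iS.
    apply: lip_onD => //; last by apply: lip_onN => //; exact: lip_on_coord.
    apply: lip_on_coord; rewrite notZ negb_and; apply/orP; right.
    by apply/existsP => -[k]; rewrite (negbTE (S'0 _ _ _ _ iS)).
  apply: lip_on_coord; case: x nj => i l /= nj.
  rewrite notZ negb_and; apply/orP; right.
  by apply/existsP => -[k]; rewrite nj.
exists (fun i => \row_l v (i, l)); split=> [i j|M M' p [MM' MN M'N pN] S0 dS cS bS].
  by rewrite mxE; exact: (vw (i, j)).
set v' := fun i => _ in bS.
have /choice[g Hg] : forall j, exists x : I * I * (I -> R), [/\ x.1.1 \in S0 j,
    x.1.2 \in S0 j, x.1.1 != x.1.2, forall i, `|x.2 i| <= 1 &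
    plane_of c M p (v' x.1.1 -
      \sum_(i in S0 j :\ x.1.1 :\ x.1.2) x.2 i *: (v' i - p))].
  move=> j; have [k0 [k1 [t]]] := excess_simplex_dependence (bS j).
  by exists ((k0, k1), t).
pose t0 : {ffun 'I_D.+1 -> data} := [ffun j => (S0 j, (g j).1.1, (g j).1.2)].
have valt0 : valid t0.
  apply/andP; split; apply/forallP => j.
    by rewrite ffunE /=; have [-> -> -> _ _] := Hg j; rewrite cS.
  apply/forallP => k; apply/forallP => i; rewrite !ffunE /=.
  by apply/implyP => ij; apply/implyP => /(dS _ _ _ ij)/eqP.
pose t : T := exist _ t0 valt0.
have SE j : S t j = S0 j by rewrite /S /= ffunE.
have i0E j : i0 t j = (g j).1.1 by rewrite /i0 /= ffunE.
have i1E j : i1 t j = (g j).1.2 by rewrite /i1 /= ffunE.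
pose E j := v' (i0 t j) - \sum_(i in S' t j) (g j).2 i *: (v' i - p) - p.
have EM j (l : 'I_m.+1) : (c <= l)%N -> (E j *m M) 0 l = 0.
  move=> cl; have [_ _ _ _ /(_ l cl) <-] := Hg j.
  by rewrite /E /S' SE i0E i1E.
pose s (x : J) : R := match x with
  | inl (i, l) => if [pick j | i0 t j == i] is Some j then
       if (l < c)%N then (E j *m M) 0 l
       else (g j).2 (nth i (enum (S' t j)) (l - c))
     else v (i, l)
  | inr (inl (k, l)) => M' k l
  | inr (inr l) => p 0 l end.
have vV i l : `|v (i, l)| <= V.
  have := vw (i, l) => /= h.
  have : `|w i 0 l| <= \sum_i \sum_j `|w i 0 j|.
    rewrite (bigD1 i) //= (bigD1 l) //= -addrA lerDl addr_ge0 //.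
      by apply: sumr_ge0.
    by do 2 ! apply: sumr_ge0 => ? _.
  move=> h'; rewrite -(subrK (w i 0 l) (v (i, l))).
  by apply: (le_trans (ler_normD _ _)); rewrite addrC /V; apply: lerD.
have EB j l : `|E j 0 l| <= #|I|.+1%:R * (V + N).
  have vp i : `|(v' i - p) 0 l| <= V + N.
    by rewrite !mxE; apply: (le_trans (ler_normB _ _)); apply: lerD.
  rewrite /E addrAC -natr1 mulrDl mul1r addrC mxE.
  apply: (le_trans (ler_normD _ _)); apply: lerD => //; rewrite !mxE normrN.
  rewrite summxE; apply: (le_trans (ler_norm_sum _ _ _)).
  apply: (@le_trans _ _ (\sum_(i in S' t j) (V + N))).
    apply: ler_sum => i _; rewrite mxE normrM -[leRHS]mul1r ler_pM //.
    by have [_ _ _ + _] := Hg j; apply.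
  rewrite sumr_const -[leLHS]mulr_natl ler_wpM2r ?ler_nat ?max_card //.
  by rewrite addr_ge0 // ltW.
have EMB j l : `|(E j *m M) 0 l| <= m.+1%:R * ((#|I|.+1%:R * (V + N)) * N).
  rewrite mxE; apply: (le_trans (ler_norm_sum _ _ _)).
  apply: (@le_trans _ _ (\sum_(k < m.+1) (#|I|.+1%:R * (V + N)) * N)).
    by apply: ler_sum => k _; rewrite normrM ler_pM.
  by rewrite sumr_const card_ord [leRHS]mulr_natl.
apply: (hv t s) => [[[i l]|[[k l]|l]]|[i l]] /=.
- case: pickP => [j _|_].
    case: ifP => _; first exact: le_trans Xr.
    have [_ _ _ g1 _] := Hg j; exact: le_trans r1.
  exact: le_trans Vr.
- exact: le_trans Nr.
- exact: le_trans Nr.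
have pickE j : [pick k | i0 t k == i0 t j] = Some j.
  case: pickP => [k /eqP/i0inj -> //|/(_ j)]; by rewrite eqxx.
rewrite /F [(i, l).1]/= [(i, l).2]/=.
have [[j ji]|nj] := pselect (exists j, i0 t j = i); last first.
  rewrite /s; case: pickP => // j /eqP ji; by case: nj; exists j.
rewrite -{i}ji pickE /s pickE.
have -> : \sum_(k < m.+1 | (k < c)%N) (if (k < c)%N then (E j *m M) 0 k
    else (g j).2 (nth (i0 t j) (enum (S' t j)) (k - c))) * M' k l = E j 0 l.
  rewrite -[in RHS](mulmx1 (E j)) -MM' mulmxA [RHS]mxE big_mkcond /=.
  apply: eq_bigr => k _; case: ltnP => // ck; by rewrite EM // mul0r.
have -> : \sum_(i in S' t j) (if (slot t j i < c)%N then (E j *m M) 0 (slot t j i)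
    else (g j).2 (nth (i0 t j) (enum (S' t j)) (slot t j i - c))) *
    ((if [pick j0 | i0 t j0 == i] is Some j0
      then if (l < c)%N then (E j0 *m M) 0 l
         else (g j0).2 (nth i (enum (S' t j0)) (l - c)) else v (i, l)) - p 0 l) =
    (\sum_(i in S' t j) (g j).2 i *: (v' i - p)) 0 l.
  rewrite summxE; apply: eq_bigr => i iS.
  have [-> _] := slotE _ _ _ iS; rewrite ltnNge leq_addr /= addKn.
  rewrite nth_index ?mem_enum //; case: pickP => [k|_].
    by rewrite (negbTE (S'0 _ _ _ _ iS)).
  by rewrite !mxE.
by rewrite /E !mxE; ring.
Qed.

(** * Content of plane sections *)

Section coordinates.
Variables (R : realType) (m : nat).
Implicit Types u v : 'rV[R]_m.

Lemma le_coord_norm v j : `|v 0 j| <= `|v|.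
Proof.
by rewrite [leRHS]mx_normrE; apply/bigmax_geP; right; exists (0, j).
Qed.

Lemma norm_le_coord v (e : R) : 0 <= e -> (forall j, `|v 0 j| <= e) -> `|v| <= e.
Proof.
move=> e0 h; rewrite [leLHS]mx_normrE; apply/bigmax_leP; split=> // -[i j] _ /=.
by rewrite (ord1 i).
Qed.

Lemma norm_lt_coord v (e : R) : 0 < e -> (forall j, `|v 0 j| < e) -> `|v| < e.
Proof.
move=> e0 h; rewrite [ltLHS]mx_normrE; apply/bigmax_ltP; split=> // -[i j] _ /=.
by rewrite (ord1 i).
Qed.

End coordinates.

Definition ball_union (R : realType) (m : nat) (s : seq ('rV[R]_m * R)) :
    set 'rV[R]_m :=
  [set v | exists2 b, b \in s & `|v - b.1| < b.2].
Arguments ball_union {R m} s _.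

(** For compact sets this bounds the one-dimensional Hausdorff content.  Radii
are positive so that their sum is not diminished by empty balls. *)
Definition content_lt (R : realType) (m : nat) (e : R) (A : set 'rV[R]_m) :=
  exists s : seq ('rV[R]_m * R), [/\ forall b, b \in s -> 0 < b.2,
    \sum_(b <- s) b.2 < e & A `<=` ball_union s].

Definition thin_slices (R : realType) (m c : nat) (N e : R) (A : set 'rV[R]_m) :=
  forall M M' p, frame N M M' p -> content_lt e (A `&` plane_of c M p).

Lemma open_ball_union (R : realType) (m : nat) (s : seq ('rV[R]_m * R)) :
  open (ball_union s).
Proof.
rewrite openE => v [b bs vb]; apply/nbhs_ballP.
exists (b.2 - `|v - b.1|); first by rewrite /= subr_gt0.
move=> u; rewrite mx_norm_ball /ball_ /= => uv; exists b => //.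
rewrite -(subrK v u) -addrA; apply: (le_lt_trans (ler_normD _ _)).
by rewrite -ltrBrDr distrC.
Qed.

Lemma continuous_sum_seq (R : realType) (V : normedModType R) (T : topologicalType)
    (I : Type) (r : seq I) (P : pred I) (F : I -> T -> V) :
  (forall i, continuous (F i)) -> continuous (fun x => \sum_(i <- r | P i) F i x).
Proof.
move=> cF; apply: continuous_big => // x.
by apply: cvgD; [exact: cvg_fst|exact: cvg_snd].
Qed.

(** The finite union of balls that covers one section is open, so by
compactness of [A] it still covers the sections by nearby planes of a
thickening of [A]; the frames bounded by [N] are compact, hence one thickness
serves all planes. *)
Lemma thin_slices_thicken (R : realType) (m c : nat) (N e : R) (A : set 'rV[R]_m) :
  compact A -> thin_slices c N e A ->
  exists2 d, 0 < d &
    thin_slices c N e [set v | exists2 u, A u & `|v - u| < d].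
Proof.
move=> cA tA.
pose FT := ('rV[R]_(m * m) * 'rV[R]_(m * m) * 'rV[R]_m)%type.
pose C : set FT := [set z | frame N (vec_mx z.1.1) (vec_mx z.1.2) z.2].
have cc (i j : 'I_m) : continuous (fun z : FT => z.1.1 0 (mxvec_index i j)).
  move=> z; apply: (@continuous_comp _ _ _ (fun z : FT => z.1.1)
    (fun M : 'rV[R]_(m * m) => M 0 (mxvec_index i j))); last exact: coord_continuous.
  by apply: (@continuous_comp _ _ _ (fun z : FT => z.1) fst);
    [exact: cvg_fst|exact: cvg_fst].
have cc' (i j : 'I_m) : continuous (fun z : FT => z.1.2 0 (mxvec_index i j)).
  move=> z; apply: (@continuous_comp _ _ _ (fun z : FT => z.1.2)
    (fun M : 'rV[R]_(m * m) => M 0 (mxvec_index i j))); last exact: coord_continuous.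
  by apply: (@continuous_comp _ _ _ (fun z : FT => z.1) snd);
    [exact: cvg_fst|exact: cvg_snd].
have cp (j : 'I_m) : continuous (fun z : FT => z.2 0 j).
  move=> z; apply: (@continuous_comp _ _ _ (fun z : FT => z.2)
    (fun M : 'rV[R]_m => M 0 j)); last exact: coord_continuous.
  exact: cvg_snd.
have cC : compact C.
  pose B k := [set v : 'rV[R]_k | forall i, `[(- N), N]%classic (v ord0 i)].
  have cB k : compact (B k).
    by apply: (@rV_compact _ _ (fun=> `[(- N), N]%classic)) => _; exact: segment_compact.
  have cBB : compact (B (m * m)%N `*` B (m * m)%N `*` B m).
    by apply: compact_setX => //; exact: compact_setX.
  have inB k (v : 'rV[R]_k) : B k v <-> forall i, `|v 0 i| <= N.
    by split=> h i; have := h i; rewrite /= in_itv /= ler_norml.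
  have -> : C = (B (m * m)%N `*` B (m * m)%N `*` B m) `&`
        \bigcap_(ij in [set: 'I_m * 'I_m])
         [set z : FT | \sum_k z.1.1 0 (mxvec_index ij.1 k) *
            z.1.2 0 (mxvec_index k ij.2) \in [set (1%:M : 'M[R]_m) ij.1 ij.2]].
      apply/seteqP; split=> z.
        move=> [MM' MN M'N pN]; split.
          split; [split|]; apply/inB => //.
            by case/mxvec_indexP => i j; have := MN i j; rewrite mxE.
          by case/mxvec_indexP => i j; have := M'N i j; rewrite mxE.
        move=> [i j] _ /=; apply/mem_set; rewrite /= -MM' mxE.
        by apply: eq_bigr => k _; rewrite !mxE.
      move=> [[[/inB h1 /inB h2] /inB h3] h4]; split=> //; last 2 first.
      - by move=> i j; rewrite mxE.
      - by move=> i j; rewrite mxE.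
      apply/matrixP => i j; have := h4 (i, j) I; rewrite /= inE /= => <-.
      by rewrite mxE; apply: eq_bigr => k _; rewrite !mxE.
  apply: compact_closedI => //.
    apply: closed_bigI => -[i j] _.
    rewrite (_ : [set z | _] = (fun z : FT => \sum_k z.1.1 0 (mxvec_index i k) *
      z.1.2 0 (mxvec_index k j)) @^-1` [set (1%:M : 'M[R]_m) i j]); last first.
      by apply/seteqP; split=> z /=; rewrite inE.
    apply: closed_comp; last exact: closed_eq.
    move=> z _; apply: (@continuous_sum_seq R R) => k.
    by move=> x; apply: cvgM; [exact: cc|exact: cc'].
have key (z : FT) : C z -> \forall z' \near z & d \near 0^'+,
    content_lt e ([set v | exists2 u, A u & `|v - u| < d] `&`
      plane_of c (vec_mx z'.1.1) z'.2).
  move=> Cz; have [s [s0 se sA]] := tA _ _ _ Cz.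
  have [Q QE] : exists Q : FT -> R -> 'rV[R]_m -> Prop, forall z' d u, Q z' d u <->
    forall v, `|v - u| < d -> plane_of c (vec_mx z'.1.1) z'.2 v -> ball_union s v.
    by eexists => z' d u; exact: iff_refl.
  have tri (u u' v : 'rV[R]_m) (d d' : R) : d' < d / 2 -> `|u - u'| < d / 2 ->
      `|v - u'| < d' -> `|u - v| < d.
    move=> d'd uu' vu'; rewrite -(subrK u' u) -addrA (splitr d).
    apply: (le_lt_trans (ler_normD _ _)); apply: ltrD => //.
    by rewrite distrC (lt_trans vu').
  have near_ball (u : 'rV[R]_m) (d : R) : 0 < d -> \forall u' \near u, `|u - u'| < d.
    by move=> d0; apply/nbhs_ballP; exists d => // x; rewrite mx_norm_ball.
  have near_snd (d : R) : 0 < d ->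
      \forall w \near filter_prod (nbhs z) (0^'+ : set_system R), w.2 < d.
    move=> d0; exists (setT, [set x | x < d]); last by move=> [? ?] [].
    by split; [exact: filterT|exact: nbhs_right_lt].
  have : \forall w \near filter_prod (nbhs z) (0^'+ : set_system R), A `<=`
      [set u | Q w.1 w.2 u].
    move/compact_near_coveringP : cA; apply => u Au.
    have [us|nus] := pselect (ball_union s u).
      have := @open_ball_union _ _ s; rewrite openE => /(_ _ us)/nbhs_ballP[d /= d0 ds].
      have d20 : 0 < d / 2 by rewrite divr_gt0.
      have H z' d' u' : d' < d / 2 -> `|u - u'| < d / 2 -> Q z' d' u'.
        move=> dd uu; apply/QE => v vu _; apply: ds; rewrite mx_norm_ball /ball_.
        exact: tri vu.
      exists ([set u' | `|u - u'| < d / 2], [set w | w.2 < d / 2]).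
        by split; [exact: near_ball|exact: near_snd].
      by move=> [u' w] [uu' wd]; exact: H.
    have [l [cl nl]] : exists l : 'I_m, (c <= l)%N /\
        ((u - z.2) *m vec_mx z.1.1) 0 l != 0.
      apply: contrapT => h; apply: nus; apply: sA; split=> // l cl.
      by apply/eqP/negPn/negP => nl; apply: h; exists l.
    pose G (x : 'rV[R]_m * FT) := \sum_k (x.1 0 k - x.2.2 0 k) * x.2.1.1 0 (mxvec_index k l).
    have GE v z' : G (v, z') = ((v - z'.2) *m vec_mx z'.1.1) 0 l.
      by rewrite mxE; apply: eq_bigr => k _; rewrite !mxE.
    have cG : continuous G.
      apply: (@continuous_sum_seq R R) => k x; apply: cvgM.
        apply: cvgB.
          apply: (@continuous_comp _ _ _ fst (fun M : 'rV[R]_m => M 0 k)).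
            exact: cvg_fst.
          exact: coord_continuous.
        by apply: (@continuous_comp _ _ _ snd (fun z : FT => z.2 0 k));
          [exact: cvg_snd|exact: cp].
      by apply: (@continuous_comp _ _ _ snd (fun z : FT => z.1.1 0 (mxvec_index k l)));
          [exact: cvg_snd|exact: cc].
    have : nbhs (u, z) [set x | G x != 0].
      apply: (cG (u, z) [set y | y != 0]).
      rewrite GE; apply: open_nbhs_nbhs; split=> //; exact: open_neq.
    case=> -[U W] [/nbhs_ballP[d d0 dU] zW] UW.
    have d20 : 0 < d / 2 by rewrite divr_gt0.
    have H z' d' u' : W z' -> d' < d / 2 -> `|u - u'| < d / 2 -> Q z' d' u'.
      move=> Wz dd uu; apply/QE => v vu /(_ l cl); rewrite -GE => /eqP; apply: contraTP => _.
      apply: UW; split=> //=; apply: dU; rewrite mx_norm_ball /ball_.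
      exact: tri vu.
    exists ([set u' | `|u - u'| < d / 2],
      [set w | W w.1] `&` [set w | w.2 < d / 2]).
      split; first exact: near_ball.
      exists (W, [set x | x < d / 2]); last by move=> [? ?] [].
      by split=> //; exact: nbhs_right_lt.
    by move=> [u' w] [uu' [Ww wd]]; exact: H.
  case=> -[U W] /= [zU dW] UW; exists (U, W) => // -[z' d] /= [Uz Wd].
  exists s; split=> // v [[u Au vu]] pv.
  have /QE := UW (z', d) (conj Uz Wd) u Au; exact.
have H : \forall d \near (0 : R)^'+, C `<=` [set z | content_lt e
   ([set v | exists2 u, A u & `|v - u| < d] `&` plane_of c (vec_mx z.1.1) z.2)].
  by move/compact_near_coveringP : cC; apply.
have [d d0 Hd] : exists2 d : R, 0 < d & C `<=` [set z | content_lt e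
   ([set v | exists2 u, A u & `|v - u| < d] `&` plane_of c (vec_mx z.1.1) z.2)].
  by have [d []] := filter_ex (filterI (nbhs_right_gt (0 : R)) H); exists d.
exists d => // M M' p fr.
by have := Hd (mxvec M, mxvec M', p); rewrite /C /= !mxvecK; exact.
Qed.

(** * Approximation by maps into polyhedra in general position *)

Lemma content_lt_sub (R : realType) (m : nat) (e : R) (A B : set 'rV[R]_m) :
  A `<=` B -> content_lt e B -> content_lt e A.
Proof. by move=> AB [s [s0 se Bs]]; exists s; split=> // v /AB/Bs. Qed.

Lemma thin_slices_sub (R : realType) (m c : nat) (N e : R) (A B : set 'rV[R]_m) :
  A `<=` B -> thin_slices c N e B -> thin_slices c N e A.
Proof.
move=> AB tB M M' p /tB; apply: content_lt_sub.
by move=> v [/AB].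
Qed.

Lemma convex_comb_near (R : realType) (m : nat) (I : finType) (a : I -> R)
    (v : I -> 'rV[R]_m) (u : 'rV[R]_m) (d : R) :
  (forall i, 0 <= a i) -> \sum_i a i = 1 ->
  (forall i, a i != 0 -> `|v i - u| <= d) -> `|\sum_i a i *: v i - u| <= d.
Proof.
move=> a0 a1 h; rewrite -[u]scale1r -a1 scaler_suml -sumrB.
apply: (le_trans (ler_norm_sum _ _ _)).
rewrite -[d]mul1r -a1 mulr_suml; apply: ler_sum => i _.
rewrite -scalerBr normrZ ger0_norm //.
by have [->|/h] := eqVneq (a i) 0; [rewrite !mul0r|exact: ler_wpM2l].
Qed.

(** Greedy choice, stopped after [q] members. *)
Lemma maximal_disjoint_family (I : finType) (bad : {set I} -> Prop) (q : nat) :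
  exists s : seq {set I}, [/\ forall S, S \in s -> bad S,
    forall j k i, (j < size s)%N -> (k < size s)%N ->
      i \in nth finset.set0 s j -> i \in nth finset.set0 s k -> j = k &
    size s = q \/ (size s < q)%N /\
      forall S, bad S -> exists2 T, T \in s & exists2 i, i \in S & i \in T].
Proof.
elim: q => [|q [s [bads ds [sq|[sq mx]]]]]; first by exists [::]; split=> //; left.
  have [mx|] := pselect (forall S, bad S ->
      exists2 T, T \in s & exists2 i, i \in S & i \in T).
    by exists s; split=> //; right; split=> //; rewrite sq.
  move=> /existsNP[S /not_implyP[bS nS]]; exists (S :: s); split.
  - by move=> T; rewrite inE => /orP[/eqP ->|/bads].
  - have nSk k i : (k < size s)%N -> i \in S -> i \in nth finset.set0 s k -> False.
      move=> ks iS ik; apply: nS; exists (nth finset.set0 s k); first exact: mem_nth.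
      by exists i.
    move=> [|j] [|k] i //= js ks ij ik; first by case: (nSk k i).
      by case: (nSk j i).
    by congr _.+1; exact: ds ij ik.
  - by left; rewrite /= sq.
by exists s; split=> //; right; split=> //; exact: ltnW.
Qed.

Definition convex_hull_of (R : realType) (m : nat) (I : finType)
    (v : I -> 'rV[R]_m) (S : {set I}) : set 'rV[R]_m :=
  [set x | exists a : I -> R, [/\ forall i, 0 <= a i, forall i, a i != 0 -> i \in S,
     \sum_i a i = 1 & x = \sum_i a i *: v i]].

(** Simplices without excess contribute one point each, covered by balls of
negligible radius; all the excess ones lie within distance 2 * d of the chosen
vertices of at most [D] of them. *)
Lemma polyhedron_content_lt (R : realType) (m c D : nat) (I : finType)
    (v : I -> 'rV[R]_m) (simp : {set I} -> Prop) (M : 'M[R]_m) (p : 'rV[R]_m)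
    (d e : R) :
  0 < d -> D%:R * (3 * d) < e ->
  (forall S i j, simp S -> i \in S -> j \in S -> `|v i - v j| <= d) ->
  (forall S : 'I_D.+1 -> {set I},
    (forall j k i, i \in S j -> i \in S k -> j = k) ->
    (forall j, simp (S j)) -> ~ (forall j, excess_simplex c v M p (S j))) ->
  content_lt e (\bigcup_(S in simp) convex_hull_of v S `&` plane_of c M p).
Proof.
move=> d0 De simpd few.
have [s [bads ds [sD|[sD mx]]]] := maximal_disjoint_family
    (fun S => simp S /\ excess_simplex c v M p S) D.+1.
  have js (j : 'I_D.+1) : (j < size s)%N by rewrite sD.
  exfalso; apply: (few (fun j => nth finset.set0 s j)).
  - move=> j k i ij ik; apply: val_inj; apply: (ds _ _ i) => //; rewrite sD.
      exact: ltn_ord.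
    exact: ltn_ord.
  - by move=> j; have [] := bads _ (mem_nth finset.set0 (js j)).
  - by move=> j; have [] := bads _ (mem_nth finset.set0 (js j)).
have /choice[b Hb] : forall S : {set I}, exists x : 'rV[R]_m, ((exists i, i \in S) ->
    exists2 i, i \in S & x = v i).
  move=> S; have [[i iS]|nS] := pselect (exists i, i \in S); last by exists 0.
  by exists (v i) => _; exists i.
have /choice[z Hz] : forall S : {set I}, exists x : 'rV[R]_m, ~ excess_simplex c v M p S ->
    forall y, convex_hull_of v S y -> plane_of c M p y -> y = x.
  move=> S; have [[x [Sx px]]|nS] := pselect (exists x,
      convex_hull_of v S x /\ plane_of c M p x); last first.
    by exists 0 => _ y Sy py; case: nS; exists y.
  exists x => nb y Sy py; apply: contrapT => ne; apply: nb.
  move: Sx px Sy py => [a [a0 aS a1 xE]] px [a' [a'0 a'S a'1 yE]] py.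
  exists a, a'; split=> //.
  - move=> i iS; split; apply/eqP/negPn/negP.
      by move/aS; exact/negP.
    by move/a'S; exact/negP.
  - by rewrite -xE -yE.
  - by move=> aa'; apply: ne; rewrite xE yE aa'.
pose r := (e - D%:R * (3 * d)) / #|{: {set I}}|.+1%:R.
have r0 : 0 < r by rewrite divr_gt0 // subr_gt0.
exists (map (fun T => (b T, 3 * d)) s ++ map (fun T => (z T, r)) (enum {: {set I}})).
split.
- by move=> x; rewrite mem_cat => /orP[/mapP[S _ ->]|/mapP[S _ ->]] //=; rewrite mulr_gt0.
- rewrite big_cat !big_map /= !big_const_seq !count_predT -enumT -cardE.
  rewrite !iter_addr !addr0 -(mulr_natl _ (size s)) -(mulr_natl r).
  apply: (@le_lt_trans _ _ (D%:R * (3 * d) + #|{: {set I}}|%:R * r)).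
    by rewrite lerD2r ler_wpM2r ?ler_nat // mulr_ge0 // ltW.
  rewrite -ltrBrDl /r mulrA ltr_pdivrMr ?ltr0n // mulrC ltr_pM2l ?subr_gt0 //.
  by rewrite ltr_nat.
move=> x [[S simpS Sx] px].
have [bS|nbS] := pselect (excess_simplex c v M p S); last first.
  exists (z S, r); last by rewrite /= (Hz _ nbS _ Sx px) subrr normr0.
  by rewrite mem_cat; apply/orP; right; apply/mapP; exists S; rewrite ?mem_enum.
have [T Ts [i iS iT]] := mx S (conj simpS bS).
exists (b T, 3 * d).
  by rewrite mem_cat; apply/orP; left; apply/mapP; exists T.
have [k kT bT] := Hb T (ex_intro _ i iT).
have [simpT _] := bads _ Ts.
rewrite /= bT; move: Sx => [a [a0 aS a1 xE]].
apply: (@le_lt_trans _ _ (d + d)); last by lra.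
rewrite xE -(subrKA (v i)).
apply: (le_trans (ler_normD _ _)); apply: lerD; last exact: simpd iT kT.
by apply: convex_comb_near => // j /aS jS; exact: simpd jS iS.
Qed.

Lemma compact_nbhs_subcover (T : topologicalType) (K : set T) (B : T -> set T) :
  compact K -> (forall x, K x -> nbhs x (B x)) ->
  exists s : seq T, (forall x, x \in s -> K x) /\
    forall z, K z -> exists2 x, x \in s & B x z.
Proof.
move=> cK KB; apply: contrapT => nos.
pose F := filter_from [set s : seq T | forall x, x \in s -> K x]
  (fun s => [set z | K z /\ forall x, x \in s -> ~ B x z]).
have FF : ProperFilter F.
  apply: filter_from_proper.
    apply: filter_from_filter; first by exists [::].
    move=> s t Ks Kt; exists (s ++ t).
      by move=> x; rewrite mem_cat => /orP[/Ks|/Kt].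
    by move=> z [Kz zst]; split; split=> // x xs; apply: zst; rewrite mem_cat xs ?orbT.
  move=> s Ks; apply: contrapT => /forallNP ns; apply: nos; exists s; split=> // z Kz.
  apply: contrapT => nz; apply: (ns z); split=> // x xs Bx; apply: nz; by exists x.
have [|x [Kx clx]] := cK F FF; first by exists [::] => // z [].
have Fx : F [set z | K z /\ forall y, y \in [:: x] -> ~ B y z].
  by exists [:: x] => // y; rewrite inE => /eqP ->.
have [z [[_ nB] Bz]] := clx _ (B x) Fx (KB _ Kx).
by apply: nB Bz; rewrite inE.
Qed.

Lemma order_le_card (T : Type) (V : set (set T)) (k n : nat)
    (B : 'I_k -> set T) (x : T) :
  (forall i, V (B i)) -> injective B ->
  ([set C | V C /\ C x] #<= `I_n.+1)%card ->
  (#|[pred i | `[< B i x >]]| <= n.+1)%N.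
Proof.
move=> VB Binj /pcard_leP[f].
pose g i : 'I_n.+1 := inord (f (B i)).
have memB i : `[< B i x >] -> B i \in [set C | V C /\ C x].
  by move=> /asboolP Bx; apply/mem_set; split.
have fn i : `[< B i x >] -> (f (B i) < n.+1)%N.
  by move=> /memB/set_mem Bi; exact: (@funS _ _ _ _ f).
rewrite -[leqRHS]card_ord -(card_in_image (f := g)) ?max_card //.
move=> i j Bi Bj /(congr1 (@nat_of_ord _)).
rewrite /g !inordK; [|exact: fn Bj|exact: fn Bi] => fij; apply/Binj.
by apply: (@inj _ _ _ f); rewrite ?memB.
Qed.

Lemma small_cover (R : realType) (X : topologicalType) (m n : nat) (K : set X)
    (g : X -> 'rV[R]_m) (d : R) :
  compact K -> covdim_lt (set_type K) n.+1 -> continuous g -> 0 < d ->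
  exists (k : nat) (O : 'I_k -> set X) (w : 'I_k -> 'rV[R]_m), [/\
    forall i, open (O i), forall x, K x -> exists i, O i x,
    forall i x, K x -> O i x -> `|g x - w i| < d &
    forall x, K x -> (#|[pred i | `[< O i x >]]| <= n.+1)%N].
Proof.
move=> cK dimK cg d0.
pose G x := [set z | `|g z - g x| < d].
have oG x : open (G x).
  rewrite (_ : G x = g @^-1` (ball (g x) d)); last first.
    by apply/seteqP; split=> z; rewrite mx_norm_ball /ball_ /G /= distrC.
  by apply: open_comp; [move=> z _; exact: cg|exact: ball_open].
have [D [DK KD]] : exists D : seq X, (forall x, x \in D -> K x) /\
    forall z, K z -> exists2 x, x \in D & G x z.
  apply: compact_nbhs_subcover => // x Kx; apply: open_nbhs_nbhs; split=> //.
  by rewrite /G /= subrr normr0.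
pose U : set (set (set_type K)) := [set set_val @^-1` G x | x in [set` D]].
have [||V [finV [oV cV] rV ordV]] := dimK U.
- exact: finite_image.
- split=> [A [x _ <-]|].
    by exists (G x).
  apply/seteqP; split=> // z _.
  have [x Dx Gx] := KD (set_val z) (set_valP z).
  by exists (set_val @^-1` G x) => //; exists x.
have [s us Vs] : exists2 s : seq (set (set_type K)), uniq s & V = [set` s].
  have /finite_seqP[s ->] := finV; exists (undup s); first exact: undup_uniq.
  by apply/seteqP; split=> x /=; rewrite mem_undup.
have Vnth (i : 'I_(size s)) : V (nth set0 s i).
  by rewrite Vs /=; exact: mem_nth.
have /choice[W HW] : forall i : 'I_(size s), exists W : set X, open W /\
    set_val @^-1` W = nth set0 s i.
  by move=> i; have [W oW WE] := oV _ (Vnth i); exists W.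
have /choice[w Hw] : forall i : 'I_(size s), exists w : 'rV[R]_m,
    nth set0 s i `<=` [set z | `|g (set_val z) - w| < d].
  by move=> i; have [A [x _ <-] BA] := rV _ (Vnth i); exists (g x).
have WE i (z : set_type K) : W i (set_val z) = nth set0 s i z.
  by have [_ <-] := HW i.
have Kval x : K x -> exists z : set_type K, set_val z = x.
  by move=> Kx; exists (SigSub (mem_set Kx)).
exists (size s), W, w; split.
- by move=> i; have [] := HW i.
- move=> x /Kval[z <-].
  have : [set: set_type K] z by [].
  rewrite -cV => -[B VB Bz]; move: (VB); rewrite Vs /= => Bs.
  have lt : (index B s < size s)%N by rewrite index_mem.
  by exists (Ordinal lt); rewrite WE /= nth_index.
- by move=> i x /Kval[z <-]; rewrite WE => /Hw.
- move=> x /Kval[z <-].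
  rewrite (@eq_card _ _ [pred i : 'I_(size s) | `[< nth set0 s i z >]]).
    apply: (@order_le_card _ _ _ _ (fun i : 'I_(size s) => nth set0 s i) z Vnth _
      (ordV z)) => i j ij; apply/val_inj/eqP.
    by rewrite -(nth_uniq set0 (ltn_ord i) (ltn_ord j)) // ij.
  by move=> i; rewrite !inE WE.
Qed.

(** Around each point of [K], complete regularity gives a function on [X] that
vanishes outside some [O i].  Finitely many of them have, on [K], a sum greater
than 1/2; [phi i] adds up those that vanish outside [O i]. *)
Lemma bump_functions (R : realType) (X : topologicalType) (K : set X) (k : nat)
    (O : 'I_k -> set X) :
  completely_regular_space X -> compact K -> (forall i, open (O i)) ->
  (forall x, K x -> exists i, O i x) ->
  exists phi : 'I_k -> X -> R, [/\ forall i, continuous (phi i),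
    forall i x, 0 <= phi i x, forall i x, phi i x != 0 -> O i x &
    forall x, K x -> 2^-1 < \sum_i phi i x].
Proof.
move=> crX cK oO cO.
have /choice[psi Hpsi] : forall x, exists psi : X -> R, [/\ continuous psi,
    forall z, 0 <= psi z, K x -> exists i, (forall z, psi z != 0 -> O i z) &
    K x -> psi x = 1].
  move=> x; have [Kx|nKx] := pselect (K x); last first.
    by exists (fun=> 0); split=> // z; exact: cvg_cst.
  have [i Oix] := cO x Kx.
  have /uniform_separatorP := crX x (~` O i) (open_closedC (oO i)) (fun h => h Oix).
  move=> /(_ R)[f [cf f01 fx fO]]; exists (fun z => 1 - f z); split=> [z|z||_].
  - by apply: cvgB; [exact: cvg_cst|exact: cf].
  - have : `[0, 1]%classic (f z) by apply: f01; exists z.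
    by rewrite /= in_itv /= subr_ge0 => /andP[].
  - move=> _; exists i => z; apply: contraNP => nOz.
    have -> : f z = 1 by apply: fO; exists z.
    by rewrite subrr.
  - by have -> : f x = 0; [apply: fx; exists x|rewrite subr0].
have oB x : open [set z | 2^-1 < psi x z].
  have [cpsi _ _ _] := Hpsi x.
  apply: (@open_comp _ _ (psi x) [set y | 2^-1 < y]); last exact: open_gt.
  by move=> z _; exact: cpsi.
have [D [DK KD]] : exists D : seq X, (forall x, x \in D -> K x) /\
    forall z, K z -> exists2 x, x \in D & [set z | 2^-1 < psi x z] z.
  apply: compact_nbhs_subcover => // x Kx; apply: open_nbhs_nbhs; split=> /=; first exact: oB.
  by have [_ _ _ ->] := Hpsi x => //; rewrite invf_lt1 // ltr1n.
pose sub x i := `[< forall z, psi x z != 0 -> O i z >].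
have psi0 x z : 0 <= psi x z by have [] := Hpsi x.
exists (fun i z => \sum_(x <- D | sub x i) psi x z); split.
- by move=> i; apply: continuous_sum_seq => x; have [] := Hpsi x.
- by move=> i z; apply: sumr_ge0.
- move=> i z; apply: contraNP => nOz; rewrite big1_seq // => x /andP[/asboolP sx _].
  by apply/eqP/negPn/negP => /sx.
move=> z /KD[x Dx /= hx]; apply: (lt_le_trans hx).
have Kx := DK _ Dx.
have [_ _ /(_ Kx)[i sx] _] := Hpsi x.
rewrite (bigD1 i) //=; apply: ler_wpDr.
  by apply: sumr_ge0 => j _; apply: sumr_ge0.
rewrite big_mkcond (big_rem x) //= ifT; last exact/asboolP.
rewrite lerDl.
by apply: sumr_ge0 => y _; case: ifP.
Qed.

(** The map is barycentric with respect to the nerve of a small cover of [K],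
with vertices moved into general position; capping the normalising sum from
below by 1/2 makes it continuous on all of [X]. *)
Lemma nerve_approximation (R : realType) (X : topologicalType) (m n : nat)
    (K : set X) (g : X -> 'rV[R]_m.+1) (eta e N : R) :
  completely_regular_space X -> compact K -> covdim_lt (set_type K) n.+1 ->
  continuous g -> (n <= m)%N -> 0 < eta -> 0 < e -> 0 < N ->
  exists h : X -> 'rV[R]_m.+1, [/\ continuous h,
    forall x, K x -> `|h x - g x| < eta &
    thin_slices (m.+1 - n) N e (h @` K)].
Proof.
move=> crX cK dimK cg nm eta0 e0 N0.
pose D := (m.+1 * m.+1 + m.+1)%N.
have D0 : (0 : R) < D%:R by rewrite ltr0n.
pose d := Num.min (eta / 3) (e / (13 * D%:R)).
have d0 : 0 < d by rewrite lt_min !divr_gt0 // mulr_gt0.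
have d1 : 2 * d < eta.
  have : d <= eta / 3 by rewrite ge_min lexx.
  by rewrite ler_pdivlMr //; lra.
have d2 : D%:R * (3 * (4 * d)) < e.
  have : d <= e / (13 * D%:R) by rewrite ge_min lexx orbT.
  rewrite ler_pdivlMr ?mulr_gt0 // => h.
  apply: (lt_le_trans _ h).
  have -> : D%:R * (3 * (4 * d)) = 12 * (D%:R * d) by ring.
  have -> : d * (13 * D%:R) = 13 * (D%:R * d) by ring.
  by rewrite ltr_pM2r ?mulr_gt0 // ltr_nat.
have [k [W [w [oO KO Ow ordO]]]] := small_cover cK dimK cg d0.
have [phi [cphi phi0 phiO Kphi]] := @bump_functions R _ _ _ _ crX cK oO KO.
have [v [vw gen]] := generic_position w nm d0 N0.
have vw' i : `|v i - w i| <= d.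
  by apply: norm_le_coord (ltW d0) _ => j; rewrite !mxE; exact: vw.
pose s x := Num.max (\sum_i phi i x) 2^-1.
have s0 x : 0 < s x by rewrite lt_max invr_gt0 ltr0n orbT.
have sK x : K x -> s x = \sum_i phi i x by move=> /Kphi h; rewrite /s max_l // ltW.
have aE x : K x -> \sum_i phi i x / s x = 1.
  by move=> Kx; rewrite -mulr_suml -sK // divff // lt0r_neq0.
have a0 i x : 0 <= phi i x / s x by rewrite divr_ge0 // ltW.
have aO i x : phi i x / s x != 0 -> W i x.
  by move=> h; apply: phiO; apply: contra_neq h => ->; rewrite mul0r.
exists (fun x => \sum_i (phi i x / s x) *: v i); split.
- apply: continuous_sum_seq => i x.
  apply: cvgZr_tmp; apply: cvgM; first exact: cphi.
  apply: cvgV; first by rewrite lt0r_neq0.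
  apply: (@continuous_max _ _ (fun x => \sum_i phi i x) (fun=> 2^-1) x);
    last exact: cvg_cst.
  by apply: (@continuous_sum_seq R R).
- move=> x Kx; apply: le_lt_trans d1.
  apply: convex_comb_near => [//||i /aO Oi]; first exact: aE.
  rewrite -(subrK (w i) (v i)) -addrA mulr_natl mulr2n.
  apply: (le_trans (ler_normD _ _)); apply: lerD => //.
  by rewrite distrC ltW //; exact: Ow.
move=> M M' p fr.
(* the order of the cover bounds the number of vertices of a simplex of the
   nerve, the common point x bounds its diameter *)
pose simp (S : {set 'I_k}) := (#|S| <= n.+1)%N /\
  exists2 x, K x & forall i, i \in S -> W i x.
apply: content_lt_sub (@polyhedron_content_lt R m.+1 (m.+1 - n) D _ v simp M p
   (4 * d) e _ d2 _ _); last 1 first.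
- move=> S dS simpS; apply: (gen _ _ _ fr S dS) => j.
  by have [] := simpS j.
- move=> x [[z Kz <-] pz]; split=> //.
  exists (finset (fun i => `[< W i z >])).
    split; last by exists z => // i; rewrite inE => /asboolP.
    by rewrite cardsE; exact: ordO.
  exists (fun i => phi i z / s z); split=> //; last exact: aE.
  by move=> i /aO Oi; rewrite inE; apply/asboolP.
- by rewrite mulr_gt0.
- move=> S i j [_ [z Kz SO]] iS jS.
  have near_z l : l \in S -> `|v l - g z| <= 2 * d.
    move=> lS; rewrite -(subrK (w l) (v l)) -addrA mulr_natl mulr2n.
    apply: (le_trans (ler_normD _ _)); apply: lerD => //.
    by rewrite distrC ltW //; apply: Ow => //; exact: SO.
  rewrite -(subrK (g z) (v i)) -addrA.
  apply: (le_trans (ler_normD _ _)).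
  have := near_z _ iS; have := near_z _ jS; rewrite (distrC (v j)).
  by lra.
Qed.

(** * Zero-dimensional paracompact spaces *)

Lemma covdim_lt_mono (T : topologicalType) (k l : nat) :
  (k <= l)%N -> covdim_lt T k -> covdim_lt T l.
Proof.
move=> kl dT U finU covU; have [V [finV covV rV oV]] := dT U finU covU.
exists V; split=> // x; apply: card_le_trans (oV x) _.
by rewrite card_le_II.
Qed.

Lemma covdim_le_lt (R : realType) (T : topologicalType) (n : nat) :
  (covdim R T <= n%:R%:E)%E -> covdim_lt T n.+1.
Proof.
move=> dT; have : (covdim R T < n.+1%:R%:E)%E.
  by apply: (le_lt_trans dT); rewrite lte_fin ltr_nat.
move=> /ereal_inf_lt[_ [k dk <-]]; rewrite lte_fin ltrBlDr natr1 ltr_nat => kn.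
exact: covdim_lt_mono dk.
Qed.

Lemma covdim_lt_le (R : realType) (T : topologicalType) (n : nat) :
  covdim_lt T n.+1 -> (covdim R T <= n%:R%:E)%E.
Proof.
move=> dT; apply: ereal_inf_lbound; exists n.+1 => //.
by rewrite -natr1 addrK.
Qed.

Lemma near_finite (T : topologicalType) (I : eqType) (D : set I)
    (P : I -> T -> Prop) (y : T) :
  finite_set D -> (forall i, D i -> \forall z \near y, P i z) ->
  \forall z \near y, forall i, D i -> P i z.
Proof.
move=> /finite_seqP[s ->]; elim: s => [|i s IH] h; first exact: nearW.
have hs j : [set` s] j -> \forall z \near y, P j z.
  by move=> /= js; apply: h; rewrite /= inE js orbT.
apply: filterS (filterI (h i (mem_head _ _)) (IH hs)) => z [Pi Ps] j /=.
by rewrite inE => /orP[/eqP ->|/Ps].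
Qed.

(** [C] is the union of those members of a disjoint open refinement of the cover
by [V] and the complement of [F] that meet [F]. *)
Lemma zero_dim_separation (T : topologicalType) (F V : set T) :
  covdim_lt T 1 -> closed F -> open V -> F `<=` V ->
  exists C, [/\ open C, closed C, F `<=` C & C `<=` V].
Proof.
move=> dT cF oV FV.
have [||B [_ [oB cB] rB dB]] := dT [set V; ~` F].
- by rewrite finite_setU; split; exact: finite_set1.
- split=> [A [->|->] //|]; first exact: closed_openC.
  apply/seteqP; split=> // z _; have [Fz|nFz] := pselect (F z).
    by exists V; [left|exact: FV].
  by exists (~` F); [right|].
have B1 A A' x : B A -> B A' -> A x -> A' x -> A = A'.
  move=> BA BA' Ax A'x; have /pcard_leP[f] := dB x.
  have f0 D : B D /\ D x -> f D = 0%N.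
    move=> h; have : (f D < 1)%N by exact: (@funS _ _ _ _ f).
    by rewrite ltnS leqn0 => /eqP.
  have fE : f A = f A' by rewrite !f0.
  by apply: (@inj _ _ _ f) fE; exact/mem_set.
exists (\bigcup_(A in [set A | B A /\ A `&` F !=set0]) A); split.
- by apply: bigcup_open => A [/oB].
- rewrite -openC (_ : ~` _ = \bigcup_(A in [set A | B A /\ ~ (A `&` F !=set0)]) A).
    by apply: bigcup_open => A [/oB].
  apply/seteqP; split=> x.
    move=> nx; have : [set: T] x by []. rewrite -cB => -[A BA Ax].
    by exists A => //; split=> // AF; apply: nx; exists A.
  by move=> [A [BA nA] Ax] [A' [BA' A'F] A'x]; apply: nA; rewrite (B1 _ _ _ BA BA' Ax A'x).
- move=> x Fx; have : [set: T] x by []. rewrite -cB => -[A BA Ax].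
  by exists A => //; split=> //; exists x.
- move=> x [A [BA [z [Az Fz]]] Ax]; have [A' [->|->] AA'] := rB _ BA; first exact: AA'.
  by case: (AA' _ Az).
Qed.

(** Members of a locally finite cover [V] are shrunk to clopen sets [W A] that
still cover; this takes a second locally finite refinement, by sets contained
in clopen subsets of members of [V].  Then the set [s y] of the members [A]
with [W A y] is locally constant in [y], and [c y] is chosen, as a function of
this set alone, so that [N (c y)] contains one of its members. *)
Lemma locally_constant_selection (T : topologicalType) (N : T -> set T) :
  paracompact_space T -> covdim_lt T 1 ->
  (forall y, open (N y)) -> (forall y, N y y) ->
  exists c : T -> T, (forall y, N (c y) y) /\
    forall y, \forall z \near y, c z = c y.
Proof.
move=> [hT pT] dT oN NN.
have [[y0 _]|noT] := pselect (exists y : T, True); last first.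
  by exists id; split=> y; exfalso; apply: noT; exists y.
have [|V [[oV cV] rV lV]] := pT (range N).
  split=> [A [y _ <-] //|]; apply/seteqP; split=> // y _.
  by exists (N y) => //; exists y.
pose clop C A := [/\ open C, closed C & C `<=` (A : set T)].
have [|V' [[oV' cV'] rV' lV']] := pT [set C | exists2 A, V A & clop C A].
  split=> [C [A _ []] //|]; apply/seteqP; split=> // y _.
  have : [set: T] y by []. rewrite -cV => -[A VA Ay].
  have c1 : closed [set y] by exact: (accessible_closed_set1 (hausdorff_accessible hT)).
  have yA : [set y] `<=` A by move=> z ->.
  have [C [oC cC yC CA]] := zero_dim_separation dT c1 (oV _ VA) yA.
  by exists C; [exists A => //; split|exact: yC].
pose S A := \bigcup_(B in [set B | V' B /\ exists2 C, clop C A & B `<=` C]) B.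
have SA A : closure (S A) `<=` A.
  move=> y cy; apply: contrapT => nAy.
  have [M yM finM] := lV' y.
  have : \forall z \near y, forall B, (V' B /\ B `&` M !=set0) ->
      (exists2 C, clop C A & B `<=` C) -> ~ B z.
    apply: near_finite => // B [V'B _].
    have [[C [oC cC CA] BC]|nC] := pselect (exists2 C, clop C A & B `<=` C); last first.
      by apply: nearW => z.
    have : nbhs y (~` C).
      by apply: open_nbhs_nbhs; split; [exact: closed_openC|move=> /CA].
    by apply: filterS => z nCz _ /BC.
  move=> /(filterI yM)/cy[z [[B [V'B BC] Bz] [Mz]]].
  by move=> /(_ B); apply=> //; split=> //; exists z.
have /choice[W HW] : forall A, exists W, V A ->
    [/\ open W, closed W, S A `<=` W & W `<=` A].
  move=> A; have [VA|nVA] := pselect (V A); last by exists set0.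
  have [C [oC cC SC CA]] := 
    zero_dim_separation dT (@closed_closure _ (S A)) (oV _ VA) (SA A).
  by exists C => _; split=> //; exact: subset_trans (@subset_closure _ _) SC.
pose s y := [set A | V A /\ W A y].
have sV y A : s y A -> A y by move=> [/HW[_ _ _ WA] /WA].
have s0 y : s y !=set0.
  have : [set: T] y by []. rewrite -cV' => -[B V'B By].
  have [C [A VA cl] BC] := rV' _ V'B.
  exists A; split=> //; have [_ _ SW _] := HW _ VA; apply: SW.
  by exists B => //; split=> //; exists C.
have sloc y : \forall z \near y, s z = s y.
  have [M yM finM] := lV y.
  have : \forall z \near y, forall A, (V A /\ A `&` M !=set0) -> (W A z <-> W A y).
    apply: near_finite => // A [VA _]; have [oW cW _ _] := HW _ VA.
    have [Wy|nWy] := pselect (W A y).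
      have : nbhs y (W A) by exact: open_nbhs_nbhs.
      by apply: filterS => z Wz; split.
    have : nbhs y (~` W A) by apply: open_nbhs_nbhs; split=> //; exact: closed_openC.
    by apply: filterS => z nWz; split.
  move=> /(filterI yM); apply: filterS => z [Mz h].
  apply/seteqP; split=> A sA; have Ay := sV _ _ sA; move: sA => [VA WA]; split=> //.
    by apply/h => //; split=> //; exists z.
  by apply/h => //; split=> //; exists y; split=> //; exact: nbhs_singleton.
have /choice[e He] : forall Q : set (set T), exists c, forall A, V A -> Q A ->
    exists2 A', Q A' & V A' -> A' `<=` N c.
  move=> Q; have [[A QA VA]|nQ] := pselect (exists2 A, Q A & V A).
    have [_ [c _ <-] AN] := rV _ VA.
    by exists c => _ _ _; exists A.
  by exists y0 => A VA QA; case: nQ; exists A.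
exists (e \o s); split=> [y|y]; last by apply: filterS (sloc y) => z /= ->.
have [A sA] := s0 y; have [VA _] := sA.
have [A' sA' A'N] := He _ _ VA sA.
by apply: A'N; [have [] := sA'|exact: sV sA'].
Qed.

(** * Uniformity on compact sets, intervals and shifted grids *)

Lemma exists_lower_bound (R : realType) (T : eqType) (s : seq T) (r : T -> R) :
  (forall x, x \in s -> 0 < r x) -> exists2 d, 0 < d & forall x, x \in s -> d <= r x.
Proof.
elim: s => [|y s IH] h; first by exists 1.
have [|d d0 dr] := IH; first by move=> x xs; apply: h; rewrite inE xs orbT.
exists (Num.min d (r y)); first by rewrite lt_min d0 h // mem_head.
move=> x; rewrite inE => /orP[/eqP ->|/dr xd]; first by rewrite ge_min lexx orbT.
by rewrite ge_min xd.
Qed.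

Lemma compact_uniform (R : realType) (T : topologicalType) (K : set T)
    (P : R -> T -> Prop) :
  compact K -> (forall r s x, 0 < r -> r <= s -> P s x -> P r x) ->
  (forall x, K x -> exists2 r, 0 < r & \forall z \near x, K z -> P r z) ->
  exists2 r, 0 < r & forall x, K x -> P r x.
Proof.
move=> cK anti loc.
have /choice[r Hr] : forall x, exists r, K x -> 0 < r /\ \forall z \near x, K z -> P r z.
  move=> x; have [Kx|nKx] := pselect (K x); last by exists 0.
  by have [r r0 h] := loc x Kx; exists r.
have [s [Ks sK]] : exists s : seq T, (forall x, x \in s -> K x) /\
    forall z, K z -> exists2 x, x \in s & [set z | K z -> P (r x) z] z.
  by apply: compact_nbhs_subcover => // x Kx; have [_] := Hr x Kx.
have [d d0 ds] : exists2 d, 0 < d & forall x, x \in s -> d <= r x.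
  by apply: exists_lower_bound => x /Ks/Hr[].
exists d => // z Kz; have [x xs] := sK z Kz.
by move=> /(_ Kz); apply: anti => //; exact: ds.
Qed.

Lemma compact_norm_bounded (R : realType) (T : topologicalType) (V : normedModType R)
    (K : set T) (f : T -> V) :
  compact K -> continuous f -> exists2 B, 0 < B & forall x, K x -> `|f x| <= B.
Proof.
move=> cK cf.
have [||r r0 h] := @compact_uniform R T K (fun r x => `|f x| * r <= 1) cK.
- by move=> r s x r0 rs; apply: le_trans; rewrite ler_wpM2l.
- move=> x _; have p0 : 0 < `|f x| + 1 by rewrite ltr_wpDl.
  exists (`|f x| + 1)^-1; first by rewrite invr_gt0.
  have : \forall z \near x, `|f z| < `|f x| + 1.
    have cn : (fun z => `|f z|) @ x --> `|f x| by apply: cvg_norm; exact: cf.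
    by apply: (cn [set y | y < `|f x| + 1]); apply: open_nbhs_nbhs; split;
      [exact: open_lt|rewrite /= ltrDl].
  by apply: filterS => z fz _; rewrite ler_pdivrMr // mul1r ltW.
exists r^-1; first by rewrite invr_gt0.
by move=> x /h; rewrite -ler_pdivlMr // div1r.
Qed.

(** Move [a] to the right end of a ball that covers it and discard that ball;
the total length decreases by at least as much as the interval does. *)
Lemma interval_not_covered (R : realType) (s : seq (R * R)) (a b : R) :
  (forall x, x \in s -> 0 < x.2) -> \sum_(x <- s) 2 * x.2 < b - a ->
  exists t, a <= t <= b /\ forall x, x \in s -> ~ `|t - x.1| < x.2.
Proof.
have [k] := ubnP (size s); elim: k s a => // k IH s a sk s0 sab.
have ab : a <= b.
  rewrite -subr_ge0; apply: le_trans (ltW sab).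
  by rewrite big_seq; apply: sumr_ge0 => x /s0 x0; rewrite mulr_ge0 // ltW.
have [[x xs ax]|na] := pselect (exists2 x, x \in s & `|a - x.1| < x.2); last first.
  by exists a; split; [rewrite lexx|move=> x xs ax; apply: na; exists x].
have ps := perm_to_rem xs.
have E : \sum_(y <- s) 2 * y.2 = 2 * x.2 + \sum_(y <- rem x s) 2 * y.2.
  by rewrite (perm_big _ ps) big_cons.
move: ax; rewrite ltr_norml => /andP[ax1 ax2].
have [||| t [/andP[xt tb] ht]] := IH (rem x s) (x.1 + x.2).
- by rewrite size_rem //; case: (s) sk xs.
- by move=> y /mem_rem/s0.
- by move: sab; rewrite E; lra.
exists t; split; first by rewrite tb andbT; lra.
move=> y; rewrite (perm_mem ps) inE => /orP[/eqP ->|/ht //].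
by rewrite ltr_norml => /andP[]; lra.
Qed.

Lemma avoid_coordinate (R : realType) (m : nat) (A : set 'rV[R]_m) (i : 'I_m) (a b : R) :
  (forall e, 0 < e -> content_lt e A) -> a < b ->
  exists t, a <= t <= b /\ forall v, A v -> v 0 i != t.
Proof.
move=> cA ab; have [|s [s0 se As]] := cA ((b - a) / 2).
  by rewrite divr_gt0 // subr_gt0.
have [||t [abt ht]] := @interval_not_covered R
    (map (fun x : 'rV[R]_m * R => (x.1 0 i, x.2)) s) a b.
- by move=> x /mapP[y /s0 y0 ->].
- by rewrite big_map -mulr_sumr /= mulrC -ltr_pdivlMr.
exists t; split=> // v /As[x xs vx]; apply/eqP => vt.
apply: (ht (x.1 0 i, x.2)); first by apply/mapP; exists x.
rewrite -vt /=; apply: le_lt_trans vx.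
by have := le_coord_norm (v - x.1) i; rewrite !mxE.
Qed.

(** For each [l], the difference w l - j / (p + 1) is an integer for at most one
[j]; there are more shifts [j] than indices [l]. *)
Lemma shifted_grid_color (R : realType) (P : finType) (p : nat) (w : P -> R) :
  (#|P| <= p)%N -> (forall l, 1 <= w l) ->
  exists j : 'I_p.+1, forall l, exists a : nat,
    a%:R < w l - j%:R / p.+1%:R < a.+1%:R.
Proof.
move=> cP w1.
have p0 : (0 : R) < p.+1%:R by rewrite ltr0n.
suff [j Hj] : exists j : 'I_p.+1, forall l (a : nat), w l - j%:R / p.+1%:R != a%:R.
  exists j => l.
  have u0 : 0 <= w l - j%:R / p.+1%:R.
    rewrite subr_ge0; apply: le_trans (w1 l).
    by rewrite ler_pdivrMr // mul1r ler_nat ltnW.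
  have /andP[h1 h2] := truncn_itv u0.
  exists (Num.truncn (w l - j%:R / p.+1%:R)); rewrite h2 andbT.
  by rewrite lt_neqAle h1 andbT eq_sym Hj.
apply: contrapT => /forallNP nj.
have /choice[l Hl] : forall j : 'I_p.+1, exists l, exists a : nat,
    w l - j%:R / p.+1%:R = a%:R.
  move=> j; have /existsNP[l /existsNP[a /negP]] := nj j.
  by rewrite negbK => /eqP; exists l, a.
have linj : injective l.
  have half (j k : 'I_p.+1) : l j = l k -> (j <= k)%N -> j = k.
    move=> jk le; have [a Ha] := Hl j; have [b Hb] := Hl k.
    have E : (k - j)%:R = (a%:R - b%:R) * p.+1%:R :> R.
      by rewrite natrB // -Ha -Hb jk; field; rewrite lt0r_neq0.
    apply/val_inj/eqP; rewrite eqn_leq le /= -subn_eq0 -leqn0.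
    have lt : ((k - j)%:R : R) < p.+1%:R by rewrite ltr_nat (leq_ltn_trans (leq_subr _ _)).
    have : (a%:R - b%:R : R) < 1 by rewrite -(ltr_pM2r p0) mul1r -E.
    rewrite ltrBlDr nat1r ltr_nat ltnS => ab.
    rewrite -(ler_nat R) E mulr_le0_ge0 // ?ler0n //.
    by rewrite subr_le0 ler_nat.
  move=> j k jk; have [le|/ltnW le] := leqP j k; first exact: half.
  by symmetry; apply: half.
have := leq_card l linj; rewrite card_ord => /leq_trans/(_ cP).
by rewrite ltnn.
Qed.

(** * Dimension of a compact set from its null fibres *)

Lemma lebesgue_number (R : realType) (m : nat) (Q : set 'rV[R]_m)
    (U : set (set (set_type Q))) :
  compact Q -> open_cover U -> exists2 d, 0 < d &
    forall x : set_type Q, exists2 A, U A &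
      forall y : set_type Q, `|set_val y - set_val x| < d -> A y.
Proof.
move=> cQ [oU cU].
have [||d d0 h] := @compact_uniform R _ Q (fun r z => exists2 A, U A &
    forall y : set_type Q, `|set_val y - z| < r -> A y) cQ.
- move=> r s x r0 rs [A UA h]; exists A => // y yx; apply: h; exact: lt_le_trans rs.
- move=> x Qx; pose x' : set_type Q := SigSub (mem_set Qx).
  have : [set: set_type Q] x' by []. rewrite -cU => -[A UA Ax].
  have [W oW WA] := oU _ UA.
  have : W (set_val x') by rewrite -WA in Ax.
  move: oW; rewrite openE => /[apply] /nbhs_ballP[r /= r0 rW].
  exists (r / 2); first by rewrite divr_gt0.
  apply/nbhs_ballP; exists (r / 2); first by rewrite /= divr_gt0.
  move=> z; rewrite mx_norm_ball /ball_ /= => xz _; exists A => // y yz.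
  rewrite -WA; apply: rW; rewrite mx_norm_ball /ball_ /=.
  rewrite -(subrKA z) (splitr r); apply: (le_lt_trans (ler_normD _ _)).
  by apply: ltrD => //; rewrite distrC.
exists d => // x; exact: h (set_valP x).
Qed.

Lemma near_forall (T : topologicalType) (I : finType) (P : I -> T -> Prop) (x : T) :
  (forall i, \forall z \near x, P i z) -> \forall z \near x, forall i, P i z.
Proof. exact: filter_forall. Qed.

Lemma near_lt (R : realType) (T : topologicalType) (f g : T -> R) (x : T) :
  continuous f -> continuous g -> f x < g x -> \forall z \near x, f z < g z.
Proof.
move=> cf cg fg; have : (fun z => g z - f z) @ x --> g x - f x.
  by apply: cvgB; [exact: cg|exact: cf].
move=> /(_ [set y | 0 < y]) h; have : nbhs x [set z | 0 < g z - f z].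
  by apply: h; apply: open_nbhs_nbhs; split; [exact: open_gt|rewrite /= subr_gt0].
by apply: filterS => z /=; rewrite subr_gt0.
Qed.

Lemma near_lt_cst (R : realType) (T : topologicalType) (f : T -> R) (x : T) (a : R) :
  continuous f -> f x < a -> \forall z \near x, f z < a.
Proof. by move=> cf; apply: near_lt => //; exact: cst_continuous. Qed.

Lemma near_gt_cst (R : realType) (T : topologicalType) (f : T -> R) (x : T) (a : R) :
  continuous f -> a < f x -> \forall z \near x, a < f z.
Proof. by move=> cf; apply: (@near_lt _ _ (fun=> a)) => //; exact: cst_continuous. Qed.

Lemma near_dist_lt (R : realType) (T : topologicalType) (f : T -> R) (x : T) (r : R) :
  continuous f -> 0 < r -> \forall z \near x, `|f z - f x| < r.
Proof.
move=> cf r0; apply: (@near_lt _ _ (fun z => `|f z - f x|) (fun=> r)).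
- move=> z; have h : (fun z => f z - f x) @ z --> f z - f x.
    by apply: cvgB; [exact: cf|exact: cvg_cst].
  exact: cvg_norm h.
- exact: cst_continuous.
- by rewrite subrr normr0.
Qed.

Lemma continuous_rescale (R : realType) (T : topologicalType) (f : T -> R) (a b c : R) :
  continuous f -> continuous (fun x => (f x + a) / b + 1 - c).
Proof.
move=> cf x; apply: cvgB; last exact: cvg_cst.
apply: cvgD; last exact: cvg_cst.
apply: cvgM; last exact: cvg_cst.
by apply: cvgD; [exact: cf|exact: cvg_cst].
Qed.

(** One cut is taken in each interval of a grid of mesh d / 3, so any interval
of length [d] contains a cut; 6 * B / d is the number of mesh intervals between
- B and B. *)
Lemma separating_cuts (R : realType) (m : nat) (A : set 'rV[R]_m) (B d : R) :
  0 < d -> 0 < B -> (forall e, 0 < e -> content_lt e A) ->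
  exists t : 'I_m -> 'I_(Num.truncn (6 * B / d)).+1 -> R,
    (forall i k v, A v -> v 0 i != t i k) /\
    forall i x y, - B <= x -> y <= B -> d <= y - x -> exists k, x <= t i k <= y.
Proof.
move=> d0 B0 cA; have d30 : 0 < d / 3 by rewrite divr_gt0.
pose L := (Num.truncn (6 * B / d)).+1.
have /choice[t Ht] : forall ik : 'I_m * 'I_L, exists t,
    ik.2%:R * (d / 3) - B <= t <= ik.2.+1%:R * (d / 3) - B /\
    forall v, A v -> v 0 ik.1 != t.
  move=> [i k] /=; apply: avoid_coordinate => //.
  by rewrite ltrD2r ltr_pM2r // ltr_nat.
exists (fun i k => t (i, k)); split=> [i k v Av|i x y Bx yB xy].
  by have [_] := Ht (i, k); apply.
have z0 : 0 <= (x + B) / (d / 3) by rewrite divr_ge0 ?(ltW d30) //; lra.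
have /andP[h1 h2] := truncn_itv z0; set k := Num.truncn _ in h1 h2.
have h1' : k%:R * (d / 3) <= x + B by rewrite -ler_pdivlMr.
have h2' : x + B < k.+1%:R * (d / 3) by rewrite -ltr_pdivrMr.
have kL : (k.+1 < L)%N.
  rewrite -(ltr_nat R) /L; apply: le_lt_trans (truncnS_gt _).
  rewrite ler_pdivlMr // -natr1; move: h1'; set kk := k%:R => h1'.
  have -> : (kk + 1) * d = 3 * (kk * (d / 3)) + d by field.
  by lra.
exists (Ordinal kL); have [/andP[t1 t2] _] := Ht (i, Ordinal kL).
move: t1 t2 h2' h1'; rewrite /= -[k.+2%:R]natr1 -[k.+1%:R]natr1 !mulrDl !mul1r.
set zz := k%:R * (d / 3); move: zz (t _) => zz tt t1 t2 h2' h1'.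
by apply/andP; split; lra.
Qed.

(** This is the case of Hurewicz's theorem on maps that lower dimension which
is needed: zero-dimensional fibres over a subset of R^p.  A member of the
refinement is indexed by a shifted grid [j], a cube [a] of that grid, and the
sides [s] of the cuts chosen for a fibre close to the cube; two members through
a point with the same [j] are equal. *)
Lemma covdim_lt_null_fibers (R : realType) (m p : nat) (P : finType)
    (Q : set 'rV[R]_m) (pi : P -> 'rV[R]_m -> R) :
  compact Q -> (#|P| <= p)%N -> (forall l, continuous (pi l)) ->
  (forall q, Q q -> forall e, 0 < e ->
     content_lt e (Q `&` [set y | forall l, pi l y = pi l q])) ->
  covdim_lt (set_type Q) p.+1.
Proof.
move=> cQ cP cpi null U finU covU.
have [d d0 Ud] := lebesgue_number cQ covU.
have [B B0 QB] := compact_norm_bounded cQ (fun x => @cvg_id _ (nbhs x)).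
have {}QB v i : Q v -> - B <= v 0 i <= B.
  by move=> /QB; rewrite -ler_norml => /(le_trans (le_coord_norm v i)).
set L := (Num.truncn (6 * B / d)).+1.
have /choice[t Ht] : forall q, exists t : 'I_m -> 'I_L -> R, Q q ->
    (forall i k v, Q v -> (forall l, pi l v = pi l q) -> v 0 i != t i k) /\
    forall i x y, - B <= x -> y <= B -> d <= y - x -> exists k, x <= t i k <= y.
  move=> q; have [Qq|nQ] := pselect (Q q); last by exists (fun _ _ => 0).
  have [t [t1 t2]] := separating_cuts d0 B0 (null q Qq).
  by exists t => _; split=> // i k v Qv vq; exact: t1.
pose good q (y : 'rV[R]_m) := forall i k, y 0 i != t q i k.
have ccoord (i : 'I_m) : continuous (fun y : 'rV[R]_m => y 0 i) by exact: coord_continuous.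
have near_good q y : good q y -> \forall z \near y, good q z.
  move=> gy; rewrite /good; apply: near_forall => i; apply: near_forall => k.
  have := gy i k; rewrite neq_lt => /orP[yt|yt].
    have := near_lt_cst (ccoord i) yt.
    by apply: filterS => z zt; rewrite lt_eqF.
  have := near_gt_cst (ccoord i) yt.
  by apply: filterS => z zt; rewrite gt_eqF.
have near_pi y (r : R) : 0 < r -> \forall z \near y, forall l, `|pi l z - pi l y| < r.
  move=> r0; apply: near_forall => l.
  exact: near_dist_lt.
(* the cuts chosen for a fibre also separate the neighbouring fibres *)
have tube q : Q q -> exists2 r, 0 < r & forall y, Q y ->
    (forall l, `|pi l y - pi l q| < r) -> good q y.
  move=> Qq; have [tq _] := Ht q Qq.
  have [||r r0 h] := @compact_uniform R _ Q (fun r y =>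
      (forall l, `|pi l y - pi l q| < r) -> good q y) cQ.
  - by move=> r s x r0 rs h xr; apply: h => l; exact: lt_le_trans rs.
  - move=> y Qy; have [yq|] := pselect (forall l, pi l y = pi l q).
      exists 1 => //; have : good q y by move=> i k; exact: tq.
      by move=> /near_good; apply: filterS.
    move=> /existsNP[l /eqP yq].
    have r0 : 0 < `|pi l y - pi l q| / 2 by rewrite divr_gt0 // normr_gt0 subr_eq0.
    exists (`|pi l y - pi l q| / 2) => //.
    apply: filterS (near_pi y _ r0) => z zy _ /(_ l) zq; exfalso.
    have := ler_distD (pi l z) (pi l y) (pi l q).
    by move: (zy l) zq; rewrite (distrC (pi l z) (pi l y)); lra.
  by exists r => // y Qy; exact: h.
have [||h h0 cell] := @compact_uniform R _ Q (fun r z => exists2 q, Q q &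
    forall y, Q y -> (forall l, `|pi l y - pi l z| < r) -> good q y) cQ.
- move=> r s x r0 rs [q Qq hq]; exists q => // y Qy yx; apply: hq => // l.
  exact: lt_le_trans rs.
- move=> x Qx; have [r r0 hr] := tube x Qx.
  have r20 : 0 < r / 2 by rewrite divr_gt0.
  exists (r / 2) => //; apply: filterS (near_pi x _ r20) => z zx _.
  exists x => // y Qy yz; apply: hr => // l.
  rewrite (splitr r); apply: (le_lt_trans (ler_distD (pi l z) _ _)).
  exact: ltrD.
have [C C0 QC] : exists2 C, 0 < C & forall l y, Q y -> `|pi l y| <= C.
  have /choice[C HC] : forall l, exists C, 0 < C /\ forall y, Q y -> `|pi l y| <= C.
    move=> l; have [C C0 hC] := @compact_norm_bounded R _ R Q (pi l) cQ (cpi l).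
    by exists C.
  exists (1 + \sum_l C l).
    by rewrite ltr_pwDl // sumr_ge0 // => l _; have [/ltW] := HC l.
  move=> l y Qy; have [_ /(_ y Qy)/le_trans] := HC l; apply.
  rewrite (bigD1 l) //= addrCA lerDl addr_ge0 // sumr_ge0 // => i _.
  by have [/ltW] := HC i.
(* Coordinates in units of the mesh h, translated by C / h + 1 so that they
   stay nonnegative after the shift and cubes are indexed by natural numbers. *)
pose u (j : 'I_p.+1) l (y : 'rV[R]_m) := (pi l y + C) / h + 1 - j%:R / p.+1%:R.
pose K := (Num.truncn ((C + C) / h + 1)).+1.
have cu j l : continuous (u j l).
  exact: continuous_rescale.
have uK j l y (a : nat) : Q y -> a%:R < u j l y -> (a < K)%N.
  move=> Qy au; rewrite -(ltr_nat R); apply: lt_trans (truncnS_gt _).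
  apply: (lt_le_trans au); rewrite /u.
  apply: (@le_trans _ _ ((pi l y + C) / h + 1)).
    by rewrite lerBlDr lerDl divr_ge0.
  rewrite lerD2r ler_pM2r ?invr_gt0 // lerD2r.
  by have := QC l y Qy; rewrite ler_norml => /andP[].
pose inc j (a : {ffun P -> 'I_K}) (y : 'rV[R]_m) := forall l, (a l)%:R < u j l y < (a l).+1%:R.
have inc_inj j a b y : inc j a y -> inc j b y -> a = b.
  move=> ha hb; apply/ffunP => l; apply/val_inj/eqP.
  have /andP[a1 a2] := ha l; have /andP[b1 b2] := hb l.
  have := lt_trans a1 b2; have := lt_trans b1 a2; rewrite !ltr_nat !ltnS => h1 h2.
  by rewrite eqn_leq h1 h2.
have inc_near j a y z l : inc j a y -> inc j a z -> `|pi l y - pi l z| < h.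
  move=> /(_ l)/andP[y1 y2] /(_ l)/andP[z1 z2].
  have E : pi l y - pi l z = (u j l y - u j l z) * h.
    by rewrite /u; field; rewrite (lt0r_neq0 h0) lt0r_neq0.
  rewrite E normrM (gtr0_norm h0) -[ltRHS]mul1r ltr_pM2r // ltr_norml.
  by move: y2 z2; rewrite -!natr1; lra.
have /choice[q Hq] : forall ja : 'I_p.+1 * {ffun P -> 'I_K}, exists q,
    (exists2 z, Q z & inc ja.1 ja.2 z) ->
    Q q /\ forall y, Q y -> inc ja.1 ja.2 y -> good q y.
  move=> [j a] /=; have [[z Qz za]|nz] := pselect (exists2 z, Q z & inc j a z); last first.
    by exists 0.
  have [q Qq hq] := cell z Qz; exists q => _; split=> // y Qy ya; apply: hq => // l.
  exact: inc_near ya za.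
pose box j a (s : {ffun 'I_m * 'I_L -> bool}) (y : 'rV[R]_m) := inc j a y /\
  forall i k, if s (i, k) then t (q (j, a)) i k < y 0 i else y 0 i < t (q (j, a)) i k.
have box_inj j a b s s' y : box j a s y -> box j b s' y -> (a, s) = (b, s').
  move=> [ya ys] [yb ys']; have ab := inc_inj _ _ _ _ ya yb.
  rewrite -ab in ys' *; congr (_, _); apply/ffunP => -[i k].
  have := ys i k; have := ys' i k; case: (s _); case: (s' _) => // h1 h2.
    by have := lt_trans h1 h2; rewrite ltxx.
  by have := lt_trans h1 h2; rewrite ltxx.
pose V : set (set (set_type Q)) := [set A | A !=set0 /\
  exists jas : 'I_p.+1 * {ffun P -> 'I_K} * {ffun 'I_m * 'I_L -> bool},
    A = [set y | box jas.1.1 jas.1.2 jas.2 (set_val y)]].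
exists V; split.
- apply: (@sub_finite_set _ _ ((fun jas : 'I_p.+1 * {ffun P -> 'I_K} *
      {ffun 'I_m * 'I_L -> bool} =>
      [set y : set_type Q | box jas.1.1 jas.1.2 jas.2 (set_val y)]) @` setT)).
    by move=> A [_ [jas ->]]; exists jas.
  exact/finite_image/finite_finset.
- split.
    move=> A [_ [[[j a] s] ->]].
    exists [set y | box j a s y] => //; rewrite openE => y [ya ys].
    have n1 : \forall z \near y, inc j a z.
      apply: near_forall => l; have /andP[h1 h2] := ya l.
      have n1 := near_gt_cst (cu j l) h1.
      have n2 := near_lt_cst (cu j l) h2.
      by move: n1 n2; apply: filterS2 => z n1 n2; apply/andP.
    have n2 : \forall z \near (y : 'rV[R]_m), forall i k,
        if s (i, k) then t (q (j, a)) i k < (z : 'rV[R]_m) 0 i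
        else (z : 'rV[R]_m) 0 i < t (q (j, a)) i k.
      apply: near_forall => i; apply: near_forall => k.
      have := ys i k; case: (s _) => h1.
        exact: near_gt_cst (ccoord i) h1.
      exact: near_lt_cst (ccoord i) h1.
    by move: n1 n2; apply: filterS2 => z n1 n2; split.
  apply/seteqP; split=> // y _; have Qy := set_valP y.
  have [|j Hj] := @shifted_grid_color R P p (fun l => (pi l (set_val y) + C) / h + 1) cP.
    move=> l; rewrite lerDr divr_ge0 ?(ltW h0) //.
    by have := QC l _ Qy; rewrite ler_norml => /andP[+ _]; rewrite -subr_ge0 opprK.
  have /choice[a0 Ha0] := Hj.
  have a0K l : (a0 l < K)%N by have /andP[h1 _] := Ha0 l; exact: uK h1.
  pose a := [ffun l => Ordinal (a0K l)].
  have ya : inc j a (set_val y) by move=> l; rewrite ffunE; exact: Ha0.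
  have [|Qq gq] := Hq (j, a); first by exists (set_val y).
  pose s := [ffun ik : 'I_m * 'I_L => t (q (j, a)) ik.1 ik.2 < (set_val y) 0 ik.1].
  have ys : box j a s (set_val y).
    split=> // i k; rewrite ffunE /=; case: ltgtP => //.
    by move=> E; have := gq _ Qy ya i k; rewrite -E eqxx.
  exists [set y | box j a s (set_val y)] => //; split; first by exists y.
  by exists ((j, a), s).
- move=> A [[x Ax] [[[j a] s] AE]]; have [A' UA' xA'] := Ud x.
  exists A' => // y Ay; apply: xA'; move: Ax Ay; rewrite AE /= => Ax Ay.
  have Qx := set_valP x; have Qy := set_valP y.
  have [|Qq gq] := Hq (j, a); first by exists (set_val x) => //; case: Ax.
  have [_ cut] := Ht _ Qq.
  have key i (v w : 'rV[R]_m) : Q v -> Q w -> box j a s v -> box j a s w ->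
      w 0 i - v 0 i < d.
    move=> Qv Qw [_ bv] [_ bw]; rewrite ltNge; apply/negP => dvw.
    have /andP[Bv _] := QB v i Qv; have /andP[_ wB] := QB w i Qw.
    have [k /andP[k1 k2]] := cut i _ _ Bv wB dvw.
    have := bv i k; have := bw i k; case: (s _) => h1 h2.
      by have := lt_le_trans h2 k1; rewrite ltxx.
    by have := lt_le_trans h1 k2; rewrite ltxx.
  apply: norm_lt_coord => // i; rewrite !mxE ltr_norml.
  by rewrite key // andbT ltrNl opprB key.
move=> x.
have /choice[F HF] : forall j : nat, exists A : set (set_type Q), forall (j' : 'I_p.+1) a s,
    j' = j :> nat -> box j' a s (set_val x) -> A = [set y | box j' a s (set_val y)].
  move=> j; have [[j' [a [s [jj xas]]]]|n] := pselect (exists (j' : 'I_p.+1) a s,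
      j' = j :> nat /\ box j' a s (set_val x)); last first.
    by exists set0 => j' a s jj xas; case: n; exists j', a, s.
  exists [set y | box j' a s (set_val y)] => k b s' kj xbs.
  have kj' : k = j' by apply/val_inj; rewrite /= kj jj.
  rewrite kj' in xbs *; by have [-> ->] := box_inj _ _ _ _ _ _ xas xbs.
apply: (card_le_trans _ (card_image_le F `I_p.+1)); apply: subset_card_le.
move=> A [[_ [[[j a] s] ->]] /= xA]; exists j; first exact: ltn_ord.
exact: HF.
Qed.

(** * Planes, fibres and gluing *)

Lemma mulmx_pid_coord (R : realType) (m d : nat) (x : 'rV[R]_m) (l : 'I_m) :
  (x *m (pid_mx d : 'M[R]_m)) 0 l = if (l < d)%N then x 0 l else 0.
Proof.
rewrite mxE (bigD1 l) //= big1 ?addr0; last first.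
  by move=> k kl; rewrite mxE val_eqE (negbTE kl) mulr0.
by rewrite mxE eqxx /=; case: ltnP; rewrite ?mulr1 ?mulr0.
Qed.

Lemma affine_plane_frame (R : realType) (m d : nat) (P : set 'rV[R]_m) :
  affine_plane d P -> exists (M M' : 'M[R]_m) p,
    M *m M' = 1%:M /\ P = plane_of d M p.
Proof.
move=> [p [W [<- ->]]]; set d' := \dim W.
pose A : 'M[R]_(d', m) := \matrix_(i < d') (vbasis W)`_i.
have sumA (u : 'rV[R]_d') : u *m A = \sum_i u 0 i *: (vbasis W)`_i.
  by rewrite mulmx_sum_row; apply: eq_bigr => i _; rewrite rowK.
have WA w : w \in W <-> exists u : 'rV[R]_d', w = u *m A.
  split=> [wW|[u ->]].
    exists (\row_i coord (vbasis W) i w); rewrite sumA {1}(coord_vbasis wW).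
    by apply: eq_bigr => i _; rewrite mxE.
  rewrite sumA; apply: memv_suml => i _; apply: memvZ; apply: vbasis_mem.
  by apply: mem_nth; rewrite size_tuple.
have rA : \rank A = d'.
  apply/eqP; rewrite -[_ == _]/(row_free A); apply: inj_row_free => u.
  rewrite sumA => u0; have /freeP/(_ _ u0) {}u0 := basis_free (vbasisP W).
  by apply/rowP => i; rewrite u0 mxE.
have AE : A = col_ebase A *m pid_mx d' *m row_ebase A.
  by move: (mulmx_ebase A); rewrite rA => ->.
move: (col_ebase_unit A) (row_ebase_unit A) AE.
set C := col_ebase A; set E := row_ebase A => uC uE AE.
exists (invmx E), E, p; split; first by rewrite mulVmx.
have dm : (d' <= m)%N by rewrite -{1}rA rank_leq_col.
have pid2 : (pid_mx d' : 'M[R]_(d', m)) =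
    (pid_mx d' : 'M[R]_(d', m)) *m (pid_mx d' : 'M[R]_m).
  by rewrite mul_pid_mx minnn (minn_idPr dm).
apply/seteqP; split=> v.
  move=> [w /= wW <-] l dl; rewrite addrAC subrr add0r.
  have /WA[u ->] := wW.
  by rewrite AE mulmxA mulmxK // pid2 !mulmxA mulmx_pid_coord ltnNge dl.
move=> pv; exists (v - p); last by rewrite addrC subrK.
apply/WA; exists ((v - p) *m invmx E *m (pid_mx d' : 'M[R]_(m, d')) *m invmx C).
rewrite AE !mulmxA mulmxKV // -[_ *m pid_mx d' *m pid_mx d']mulmxA mul_pid_mx minnn minnn.
suff -> : (v - p) *m invmx E *m (pid_mx d' : 'M[R]_m) = (v - p) *m invmx E.
  by rewrite mulmxKV.
by apply/rowP => l; rewrite mulmx_pid_coord; case: ltnP => // /pv.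
Qed.

Lemma frame_bound (R : realType) (m : nat) (M M' : 'M[R]_m) (p : 'rV[R]_m) :
  M *m M' = 1%:M -> exists k0, forall k, (k0 <= k)%N -> frame k.+1%:R M M' p.
Proof.
move=> MM'.
pose B : R := \sum_i \sum_j `|M i j| + \sum_i \sum_j `|M' i j| + \sum_j `|p 0 j|.
have s0 (Z : 'M[R]_m) : 0 <= \sum_i \sum_j `|Z i j|.
  by apply: sumr_ge0 => i _; apply: sumr_ge0.
have p0 : 0 <= \sum_j `|p 0 j| by apply: sumr_ge0.
have le_sum (Z : 'M[R]_m) i j : `|Z i j| <= \sum_i \sum_j `|Z i j|.
  rewrite (bigD1 i) //= (bigD1 j) //= -addrA lerDl addr_ge0 //.
    by apply: sumr_ge0.
  by apply: sumr_ge0 => k _; apply: sumr_ge0.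
exists (Num.truncn B) => k Bk.
have Bk' : B <= k.+1%:R.
  by apply: (le_trans (ltW (truncnS_gt _))); rewrite ler_nat ltnS.
have := s0 M; have := s0 M'; rewrite /B in Bk'.
split=> // [i j|i j|j]; apply: le_trans Bk'.
- by apply: (le_trans (le_sum _ _ _)); rewrite -addrA lerDl addr_ge0.
- by apply: (le_trans (le_sum _ _ _)); rewrite addrAC lerDr addr_ge0.
- apply: (@le_trans _ _ (\sum_j `|p 0 j|)); last by rewrite lerDr addr_ge0.
  by rewrite (bigD1 j) //= lerDl; apply: sumr_ge0.
Qed.

Lemma continuous_affine_comb (R : realType) (T : topologicalType) (I : finType)
    (F : I -> T -> R) (a b : I -> R) :
  (forall i, continuous (F i)) -> continuous (fun x => \sum_i (F i x - a i) * b i).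
Proof.
move=> cF; apply: (@continuous_sum_seq R R) => i x.
apply: cvgM; last exact: cvg_cst.
by apply: cvgB; [exact: cF|exact: cvg_cst].
Qed.

Lemma closed_plane_of (R : realType) (m c : nat) (M : 'M[R]_m) (p : 'rV[R]_m) :
  closed (plane_of c M p).
Proof.
rewrite (_ : plane_of c M p = \bigcap_(l in [set l : 'I_m | (c <= l)%N])
  [set v | \sum_k (v 0 k - p 0 k) * M k l = 0]); last first.
  have E v l : ((v - p) *m M) 0 l = \sum_k (v 0 k - p 0 k) * M k l.
    by rewrite mxE; apply: eq_bigr => k _; rewrite !mxE.
  by apply/seteqP; split=> v h l cl; [rewrite /= -E|rewrite E]; exact: h.
apply: closed_bigI => l _.
apply: (@closed_comp _ _ (fun v : 'rV[R]_m => \sum_k (v 0 k - p 0 k) * M k l)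
  [set x | x = 0]); last exact: closed_eq.
move=> v _; apply: (@continuous_affine_comb R _ _ (fun k (v : 'rV[R]_m) => v 0 k)) => k.
exact: coord_continuous.
Qed.

Lemma continuous_linear_coord (R : realType) (m : nat) (M : 'M[R]_m) (l : 'I_m) :
  continuous (fun v : 'rV[R]_m => (v *m M) 0 l).
Proof.
rewrite (_ : (fun v : 'rV[R]_m => _) = fun v => \sum_k (v 0 k - 0) * M k l); last first.
  by apply/funext => v; rewrite mxE; apply: eq_bigr => k _; rewrite subr0.
apply: (@continuous_affine_comb R _ _ (fun k (v : 'rV[R]_m) => v 0 k)) => k.
exact: coord_continuous.
Qed.

(** The coordinates between [c] and [d] in a basis adapted to the plane have as
fibres the sections by planes of dimension [c]. *)
Lemma covdim_plane_section (R : realType) (m c d : nat) (A P : set 'rV[R]_m) :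
  compact A -> (c <= d)%N ->
  (forall k : nat, thin_slices c k.+1%:R k.+1%:R^-1 A) -> affine_plane d P ->
  (covdim R (set_type (A `&` P)) <= (d - c)%N%:R%:E)%E.
Proof.
move=> cA cd tA /affine_plane_frame[M [M' [p [MM' ->]]]].
apply: covdim_lt_le.
apply: (@covdim_lt_null_fibers R m (d - c) {l : 'I_m | (c <= l < d)%N}
  (A `&` plane_of d M p) (fun l v => (v *m M) 0 (val l))).
- by apply: compact_closedI => //; exact: closed_plane_of.
- have lt (l : {l : 'I_m | (c <= l < d)%N}) : (val l - c < d - c)%N.
    by have /andP[cl ld] := valP l; rewrite ltn_sub2r // (leq_ltn_trans cl).
  have : injective (fun l => Ordinal (lt l)).
    move=> l l' /(congr1 val) /= E; apply/val_inj/val_inj => /=.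
    have /andP[cl _] := valP l; have /andP[cl' _] := valP l'.
    by rewrite -(subnK cl) E subnK.
  by move=> /leq_card; rewrite card_ord.
- by move=> l; exact: continuous_linear_coord.
move=> q [Aq pq] e e0.
have [k0 fr] := frame_bound q MM'.
pose k := maxn k0 (Num.truncn e^-1).
have ke : k.+1%:R^-1 < e.
  rewrite invf_plt ?posrE //; apply: lt_le_trans (truncnS_gt _) _.
  by rewrite ler_nat ltnS leq_maxr.
have [s [s0 se sA]] := tA k _ _ _ (fr k (leq_maxl _ _)).
exists s; split=> //; first exact: lt_trans ke.
move=> v [[Av pv] vq]; apply: sA; split=> // l cl.
have [ld|dl] := ltnP l d.
  have cld : (c <= l < d)%N by rewrite cl.
  move: (vq (exist _ l cld)); rewrite /= mulmxBl.
  by move: (v *m M) (q *m M) => x y E; rewrite !mxE E subrr.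
move: (pv l dl) (pq l dl); rewrite !mulmxBl; 
move: (v *m M) (q *m M) (p *m M) => x y z; rewrite !mxE.
by move=> /eqP; rewrite subr_eq0 => /eqP -> /eqP; rewrite subr_eq0 => /eqP ->; rewrite subrr.
Qed.

Lemma perfect_map_tube (X Y : topologicalType) (f : X -> Y) (G : set X) (y : Y) :
  perfect_map f -> open G -> f @^-1` [set y] `<=` G ->
  exists W, [/\ open W, W y & f @^-1` W `<=` G].
Proof.
move=> [_ clf _] oG yG; exists (~` (f @` (~` G))); split.
- by apply: closed_openC; apply: clf; exact: open_closedC.
- by move=> [x nGx fxy]; apply: nGx; exact: yG.
- by move=> x nfx; apply: contrapT => nGx; apply: nfx; exists x.
Qed.

(** Closeness to [g] is required on the fibre of [y'] alone, so that the
tolerance may change from one fibre to another, as locally constant choices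
along [Y] will do. *)
Lemma thin_slices_nearby (R : realType) (X Y : topologicalType) (m c : nat)
    (f : X -> Y) (g : X -> 'rV[R]_m) (N e : R) (y : Y) :
  perfect_map f -> continuous g ->
  thin_slices c N e (g @` (f @^-1` [set y])) ->
  exists W d, [/\ open W, W y, 0 < d & forall (h : X -> 'rV[R]_m) y', W y' ->
    (forall x, f x = y' -> `|h x - g x| <= d) ->
    thin_slices c N e (h @` (f @^-1` [set y']))].
Proof.
move=> pf cg tg; have [_ _ kf] := pf.
have cgK : compact (g @` (f @^-1` [set y])).
  by apply: continuous_compact (kf y); exact: continuous_subspaceT.
have [d d0 td] := thin_slices_thicken cgK tg.
pose G := \bigcup_(x0 in f @^-1` [set y]) [set x | `|g x - g x0| < d / 2].
have d20 : 0 < d / 2 by rewrite divr_gt0.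
have [||W [oW Wy WG]] := perfect_map_tube (G := G) (y := y) pf.
- apply: bigcup_open => x0 _.
  rewrite (_ : [set x | _] = g @^-1` (ball (g x0) (d / 2))); last first.
    by apply/seteqP; split=> z; rewrite mx_norm_ball /ball_ /= distrC.
  by apply: open_comp; [move=> z _; exact: cg|exact: ball_open].
- by move=> x fx; exists x => //=; rewrite subrr normr0.
exists W, (d / 2); split=> // h y' Wy' hg.
apply: thin_slices_sub td => _ [x fx <-].
have [x0 fx0 /= gx] : G x by apply: WG; rewrite /= fx.
exists (g x0); first by exists x0.
rewrite -(subrKA (g x)) (splitr d); apply: (le_lt_trans (ler_normD _ _)).
by apply: ler_ltD => //; exact: hg.
Qed.

Lemma locally_constant_continuous (T S : topologicalType) (F : T -> S) :
  (forall x, \forall z \near x, F z = F x) -> continuous F.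
Proof.
by move=> h x B /nbhs_singleton Bx; apply: filterS (h x) => z; rewrite /= => ->.
Qed.

Lemma locally_equal_continuous (T S : topologicalType) (I : Type) (G : I -> T -> S)
    (i : T -> I) :
  (forall j, continuous (G j)) -> (forall x, \forall z \near x, i z = i x) ->
  continuous (fun x => G (i x) x).
Proof.
move=> cG ci x B /(cG (i x)) hB.
by apply: filterS (filterI (ci x) hB) => z [/= ->].
Qed.

(** * The source limitation topology and the theorem *)

Section euclidean_vs_sup_norm.
Variables (R : realType) (m : nat).
Implicit Types u v : 'rV[R]_m.

Lemma norm_le_eucl_dist u v : `|u - v| <= eucl_dist u v.
Proof.
apply: norm_le_coord => [|j]; first exact: sqrtr_ge0.
rewrite !mxE -sqrtr_sqr ler_sqrt; last by apply: sumr_ge0 => i _; exact: sqr_ge0.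
by rewrite (bigD1 j) //= lerDl; apply: sumr_ge0 => i _; exact: sqr_ge0.
Qed.

Lemma eucl_dist_le_norm u v : eucl_dist u v <= m%:R * `|u - v|.
Proof.
rewrite /eucl_dist -[leRHS]ger0_norm ?mulr_ge0 // -sqrtr_sqr ler_sqrt ?sqr_ge0 //.
apply: (@le_trans _ _ (\sum_(i < m) `|u - v| ^+ 2)).
  apply: ler_sum => i _; rewrite -[leLHS]real_normK ?num_real //.
  rewrite ler_pXn2r ?nnegrE // (le_trans _ (le_coord_norm (u - v) i)) //.
  by rewrite !mxE.
rewrite sumr_const card_ord -[leLHS]mulr_natl exprMn ler_wpM2r ?sqr_ge0 //.
by rewrite -natrX ler_nat; case: (m) => // k; rewrite -mulnn leq_pmulr.
Qed.

End euclidean_vs_sup_norm.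

Lemma bounded_fun_near (R : realType) (T : Type) (V : normedModType R) (g l : T -> V) :
  bounded_fun g -> (forall x, `|l x - g x| <= 1) -> bounded_fun l.
Proof.
move=> [B [Br hB]] lg; exists (B + 1); split; first exact: num_real.
move=> M BM x _ /=; rewrite -(subrK (g x) (l x)).
apply: (le_trans (ler_normD _ _)); rewrite -(subrKC 1 M) lerD //.
by apply: (hB (M - 1)) => //; rewrite ltrBrDr.
Qed.

Section baire.
Variables (R : realType) (X : topologicalType) (m : nat).
Local Notation C := (bcmap X R m.+1).

Definition radius (a : X -> R) := continuous a /\ forall x, 0 < a x.

Definition sup_ball (g : C) (a : X -> R) : set C :=
  [set h | forall x, `|h x - g x| <= a x].

Lemma radius_min a b : radius a -> radius b -> radius (a \min b).
Proof.
move=> [ca a0] [cb b0]; split; last by move=> x; rewrite /= lt_min a0 b0.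
by move=> x; apply: continuous_min; [exact: ca|exact: cb].
Qed.

Lemma radius_scale (c : R) a : 0 < c -> radius a -> radius (fun x => c * a x).
Proof.
move=> c0 [ca a0]; split; last by move=> x; rewrite mulr_gt0.
by move=> x; apply: cvgM; [exact: cvg_cst|exact: ca].
Qed.

Lemma radius_cst (c : R) : 0 < c -> radius (fun=> c).
Proof. by move=> c0; split=> // x; exact: cvg_cst. Qed.

Lemma sup_ball_open (U : set C) :
  (forall g, U g -> exists a, radius a /\ sup_ball g a `<=` U) -> open U.
Proof.
move=> h; rewrite bcmap_openE => g /h[a [[ca a0] aU]]; exists a; split=> // k gk.
apply: aU => x; apply: le_trans (gk x).
by rewrite distrC; exact: norm_le_eucl_dist.
Qed.

Lemma open_sup_ball (U : set C) (g : C) :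
  open U -> U g -> exists a, radius a /\ sup_ball g a `<=` U.
Proof.
rewrite bcmap_openE => /[apply] -[a [ca a0 aU]].
exists (fun x => m.+1%:R^-1 * a x); split; first by apply: radius_scale; rewrite ?invr_gt0.
move=> h gh; apply: aU => x; apply: (le_trans (eucl_dist_le_norm _ _)).
by rewrite distrC -ler_pdivlMl // gh.
Qed.

(** Radii bounded by 2^-k make the convergence uniform, hence the limit is
continuous and bounded. *)
Lemma limit_of_nested_balls (g : nat -> C) (a : nat -> X -> R) :
  (forall k x, 0 < a k x <= 2^-1 ^+ k) ->
  (forall j k, (k <= j)%N -> sup_ball (g k) (a k) (g j)) ->
  exists l : C, forall k, sup_ball (g k) (a k) l.
Proof.
move=> a0 ga.
have small (e : R) : 0 < e -> exists k, forall x, a k x < e.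
  move=> e0; have : (2^-1 : R) ^+ k @[k --> \oo] --> (0 : R).
    by apply: cvg_expr; rewrite ger0_norm ?invr_ge0 // invf_lt1 // ltr1n.
  move=> /cvgr0_norm_lt/(_ e e0)[k _ /(_ k (leqnn k))] /= hk.
  exists k => x; have /andP[_ /le_lt_trans] := a0 k x; apply.
  by move: hk; rewrite ger0_norm // exprn_ge0 // invr_ge0.
have /choice[l Hl] : forall x, exists l : 'rV[R]_m.+1, forall k, `|l - g k x| <= a k x.
  move=> x; have : cvg (g k x @[k --> \oo]).
    apply: cauchy_cvg; apply: cauchy_exP => e /small[k ke].
    exists (g k x); exists k => // j /= kj; rewrite mx_norm_ball /ball_ /=.
    by rewrite distrC; apply: le_lt_trans (ke x); exact: ga.
  set l := lim _ => cl; exists l => k; rewrite leNgt; apply/negP => kl.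
  have e0 : 0 < `|l - g k x| - a k x by rewrite subr_gt0.
  move/cvgrPdist_lt: cl => /(_ _ e0)[j0 _ hj].
  have := hj (maxn j0 k) (leq_maxl _ _); rewrite /= ltNge => /negP; apply.
  rewrite lerBlDr -(subrKA (g (maxn j0 k) x)).
  apply: (le_trans (ler_normD _ _)); rewrite lerD2l.
  exact: (ga _ _ (leq_maxr _ _)).
have cl : continuous l.
  move=> x; apply/cvgrPdist_lt => e e0.
  have e30 : 0 < e / 3 by rewrite divr_gt0.
  have [k ke] := small _ e30.
  have /cvgrPdist_lt/(_ _ e30) := @bcmap_continuous _ _ _ (g k) x.
  apply: filterS => z gz.
  have -> : l x - l z = (l x - g k x) + (g k x - g k z) + (g k z - l z).
    by rewrite subrKA subrKA.
  have h1 := le_lt_trans (Hl x k) (ke x).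
  have h2 : `|g k z - l z| < e / 3 by rewrite distrC; exact: le_lt_trans (Hl z k) (ke z).
  apply: (le_lt_trans (ler_normD _ _)).
  have := ler_normD (l x - g k x) (g k x - g k z).
  by move: h1 h2 gz; move: `|_| `|_| `|_| `|_| => *; lra.
have bl : bounded_fun l.
  apply: (bounded_fun_near (@bcmap_bounded _ _ _ (g 0%N))) => x.
  by apply: (le_trans (Hl x 0%N)); have /andP[] := a0 0%N x.
by exists (BCMap cl bl) => k x; exact: Hl.
Qed.

(** The sup-norm balls with continuous radii are nested as closed balls are in
the complete metric case: every open set contains such a ball around each of
its points, and a smaller ball can be placed in each [U k]. *)
Lemma baire_bcmap (U : nat -> set C) :
  (forall k g, U k g -> exists a, radius a /\ sup_ball g a `<=` U k) ->
  (forall k g a, radius a -> exists2 h, U k h & sup_ball g a h) ->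
  dense (\bigcap_k U k).
Proof.
move=> oU dU O [g0 Og0] oO.
have [a0 [ra0 a0O]] := open_sup_ball oO Og0.
have /choice[F HF] : forall ks : nat * (C * (X -> R)), exists s : C * (X -> R),
    radius ks.2.2 -> [/\ radius s.2, sup_ball s.1 s.2 `<=` U ks.1,
      sup_ball s.1 s.2 `<=` sup_ball ks.2.1 ks.2.2 &
      forall x, s.2 x <= 2^-1 * ks.2.2 x].
  move=> [k [g a]] /=; have [ra|nra] := pselect (radius a); last by exists (g, a).
  have ra2 : radius (fun x => 2^-1 * a x) by apply: radius_scale; rewrite ?invr_gt0.
  have [h Uh gh] := dU k g _ ra2; have [b [rb bU]] := oU k h Uh.
  exists (h, b \min (fun x => 2^-1 * a x)) => _; split=> /=.
  - exact: radius_min.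
  - move=> l hl; apply: bU => x; apply: (le_trans (hl x)).
    by rewrite /= ge_min lexx.
  - move=> l hl x; rewrite -(subrKA (h x)); apply: (le_trans (ler_normD _ _)).
    have := gh x; have := hl x; rewrite /= le_min => /andP[_].
    by move: `|_| `|_| => *; lra.
  - by move=> x; rewrite ge_min lexx orbT.
(* the minimum with 1 starts the geometric decay of the radii *)
pose s := fix s k := if k is k'.+1 then F (k', s k') else (g0, a0 \min (fun=> 1)).
have rs k : radius (s k).2.
  elim: k => [|k IH]; first by apply: radius_min => //; exact: radius_cst.
  by have [] := HF (k, s k) IH.
have sS k := HF (k, s k) (rs k).
have [||l Hl] := @limit_of_nested_balls (fun k => (s k).1) (fun k => (s k).2).
- move=> k x; have [_ -> /=] := rs k; elim: k => [|k IH].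
    by rewrite expr0 /= ge_min lexx orbT.
  have [_ _ _ /(_ x)/le_trans] := sS k; apply.
  by rewrite exprS ler_pM2l // invr_gt0.
- move=> j k kj x.
  suff : sup_ball (s j).1 (s j).2 `<=` sup_ball (s k).1 (s k).2.
    by apply => z; rewrite subrr normr0 ltW //; have [] := rs j.
  elim: j kj => [|j IH]; first by rewrite leqn0 => /eqP ->.
  rewrite leq_eqVlt => /orP[/eqP -> //|/IH]; apply: subset_trans.
  by have [] := sS j.
exists l; split.
  apply: a0O => x; apply: (le_trans (Hl 0%N x)).
  by rewrite /= ge_min lexx.
by move=> k _; have [_ + _ _] := sS k; apply; exact: (Hl k.+1).
Qed.

End baire.

Section generic_maps.
Variables (R : realType) (X Y : topologicalType) (n m : nat) (f : X -> Y).
Hypotheses (crX : completely_regular_space X) (paraY : paracompact_space Y).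
Hypotheses (pf : perfect_map f) (dimY : covdim_lt Y 1) (nm : (n <= m)%N).
Hypothesis dimf : forall y, covdim_lt (set_type (f @^-1` [set y])) n.+1.
Variables (N e : R).
Hypotheses (N0 : 0 < N) (e0 : 0 < e).

Definition thin_maps : set (bcmap X R m.+1) :=
  [set g | forall y, thin_slices (m.+1 - n) N e
     ((g : X -> 'rV[R]_m.+1) @` (f @^-1` [set y]))].

Lemma thin_maps_open (g : bcmap X R m.+1) :
  thin_maps g -> exists a, radius a /\ sup_ball g a `<=` thin_maps.
Proof.
move=> tg; have [cf _ _] := pf.
have /choice[Wd HWd] : forall y, exists Wd : set Y * R, [/\ open Wd.1, Wd.1 y, 0 < Wd.2 &
    forall (h : X -> 'rV[R]_m.+1) y', Wd.1 y' ->
    (forall x, f x = y' -> `|h x - g x| <= Wd.2) ->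
    thin_slices (m.+1 - n) N e (h @` (f @^-1` [set y']))].
  move=> y; have [W [d [? ? ? ?]]] :=
    thin_slices_nearby pf (@bcmap_continuous _ _ _ g) (tg y).
  by exists (W, d).
have [||c [Wc locc]] := @locally_constant_selection Y (fun y => (Wd y).1) paraY dimY.
- by move=> y; have [] := HWd y.
- by move=> y; have [] := HWd y.
exists (fun x => (Wd (c (f x))).2); split.
  split; last by move=> x; have [] := HWd (c (f x)).
  apply: locally_constant_continuous => x.
  have cx : \forall z \near x, c (f z) = c (f x) := cf x _ (locc (f x)).
  by apply: filterS cx => z /= ->.
move=> h gh y; have [_ _ _ H] := HWd (c y).
apply: H; first exact: Wc.
by move=> x fx; have := gh x; rewrite fx.
Qed.

Lemma thin_maps_dense (g : bcmap X R m.+1) (a : X -> R) :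
  radius a -> exists2 h, thin_maps h & sup_ball g a h.
Proof.
move=> ra; have [cf _ kf] := pf.
have cg := @bcmap_continuous _ _ _ g.
pose b := a \min (fun=> 1).
have [cb b0] : radius b by apply: radius_min => //; exact: radius_cst.
have /choice[Wh HWh] : forall y, exists Wh : set Y * (X -> 'rV[R]_m.+1),
    [/\ open Wh.1, Wh.1 y, continuous Wh.2,
     forall x, Wh.1 (f x) -> `|Wh.2 x - g x| <= b x &
     forall y', Wh.1 y' -> thin_slices (m.+1 - n) N e (Wh.2 @` (f @^-1` [set y']))].
  move=> y; have [||r r0 rb] := @compact_uniform R X (f @^-1` [set y])
    (fun r x => r <= b x) (kf y).
  - by move=> r s x _ rs; exact: le_trans.
  - move=> x _; have b20 : 0 < b x / 2 by rewrite divr_gt0.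
    exists (b x / 2) => //.
    have : b x / 2 < b x by rewrite ltr_pdivrMr // ltr_pMr // ltr1n.
    by move=> /(near_gt_cst cb); apply: filterS => z /ltW.
  have [h [ch hg th]] := nerve_approximation crX (kf y) (@dimf y) cg nm r0 e0 N0.
  have [W1 [d [oW1 W1y d0 H1]]] := thin_slices_nearby pf ch th.
  have cd : continuous (fun x => `|h x - g x|).
    move=> x; have hB : (fun z => h z - g z) @ x --> h x - g x.
      by apply: cvgB; [exact: ch|exact: cg].
    exact: cvg_norm hB.
  have [||W2 [oW2 W2y W2b]] := perfect_map_tube (G := [set x | `|h x - g x| < b x]) (y := y) pf.
  - by rewrite openE => x; exact: near_lt cd cb.
  - by move=> x fx /=; apply: (lt_le_trans (hg x fx)); exact: rb.
  exists (W1 `&` W2, h); split=> //=.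
  - exact: openI.
  - by move=> x [_ W2x]; apply/ltW/(W2b x).
  - by move=> y' [W1y' _]; apply: H1 => // x _; rewrite subrr normr0 ltW.
have [||c [Wc locc]] := @locally_constant_selection Y (fun y => (Wh y).1) paraY dimY.
- by move=> y; have [] := HWh y.
- by move=> y; have [] := HWh y.
pose h x := (Wh (c (f x))).2 x.
have hb x : `|h x - g x| <= b x.
  by have [_ _ _ H _] := HWh (c (f x)); apply: H; exact: Wc.
have ch : continuous h.
  apply: (@locally_equal_continuous X _ Y (fun y => (Wh y).2) (c \o f)).
    by move=> y; have [] := HWh y.
  by move=> x; exact: (cf x _ (locc (f x))).
have bh : bounded_fun h.
  apply: (bounded_fun_near (@bcmap_bounded _ _ _ g)) => x.
  by apply: (le_trans (hb x)); rewrite /b /= ge_min lexx orbT.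
exists (BCMap ch bh).
  move=> y; have [_ _ _ _ /(_ y (Wc y))] := HWh (c y).
  apply: thin_slices_sub => _ [x fx <-]; exists x => //.
  by rewrite /= /h fx.
by move=> x; apply: (le_trans (hb x)); rewrite /b /= ge_min lexx.
Qed.

End generic_maps.

Theorem theorem1p3 (R : realType) (X Y : topologicalType) (n : nat)
    (f : X -> Y)
    (tychX : tychonoff_space X) (tychY : tychonoff_space Y)
    (paraX : paracompact_space X) (paraY : paracompact_space Y)
    (perf_f : perfect_map f)
    (dim_f : (covdim_map R f <= n%:R%:E)%E)
    (dim_Y : covdim R Y = 0%:E) :
  forall m : nat, (n + 1 <= m)%N ->
  exists H : set (bcmap X R m),
    [/\ dense H, Gdelta H &
        forall g : bcmap X R m, H g ->
        forall (y : Y) (d : nat) (P : set 'rV[R]_m),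
          (m - n <= d <= m)%N -> affine_plane d P ->
          (covdim R (set_type (((g : X -> 'rV[R]_m) @` (f @^-1` [set y])) `&` P))
             <= (n%:R + d%:R - m%:R)%:E)%E].
Proof.
case=> [|m]; first by rewrite addn1.
rewrite addn1 ltnS => nm.
have dY : covdim_lt Y 1 by apply: (@covdim_le_lt R Y 0); rewrite dim_Y.
have df y : covdim_lt (set_type (f @^-1` [set y])) n.+1.
  apply: (@covdim_le_lt R); apply: le_trans dim_f.
  by apply: ereal_sup_ubound; exists y.
have [_ crX] := tychX; have [_ _ kf] := perf_f.
pose U k := @thin_maps R X Y n m f k.+1%:R k.+1%:R^-1.
exists (\bigcap_k U k); split.
- apply: baire_bcmap => [k g Ug|k g a ra]; first exact: thin_maps_open Ug.
  by apply: thin_maps_dense => //; rewrite invr_gt0.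
- exists U => // k; apply: sup_ball_open => g; exact: thin_maps_open.
move=> g Ug y d P /andP[md dm] aP.
have -> : n%:R + d%:R - m.+1%:R = (d - (m.+1 - n))%N%:R :> R.
  rewrite natrB // natrB; last exact: leqW.
  by rewrite opprB addrA (addrC d%:R).
apply: covdim_plane_section => //.
  apply: continuous_compact (kf y); apply: continuous_subspaceT.
  exact: bcmap_continuous.
by move=> k; exact: Ug.
Qed.
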